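(* Let $f\in L^1(\mathbb T^\infty)$. Then the Fejér means of $f$ converge to $f$ over cubes in the enhanced sense almost everywhere on $\mathbb T^\infty$. That is, for almost every $x\in\mathbb T^\infty$ the following holds: for every $p\in\mathbb N$ the finite limit $$\sigma_p(x)=\lim_{N\to\infty}\sigma_{p,N,\dots,N}(x)$$ exists (where the index $N$ is repeated $p$ times), and $\lim_{p\to\infty}\sigma_p(x)=f(x)$.
   Context: Let $\mathbb T=\mathbb R/\mathbb Z$ with Lebesgue measure normalized to total mass $1$. The infinite-dimensional torus $\mathbb T^\infty$ is the product of countably many copies of $\mathbb T$, with points $x=(x_1,x_2,\dots)$, equipped with the product of the normalized Lebesgue measures (equivalently, its normalized Haar measure); ''almost everywhere'' and $L^1(\mathbb T^\infty)$ (complex-valued functions) refer to this measure. For an integer $l\ge 0$, $D_l(t)=\sum_{j=-l}^{l}e^{2\pi i jt}$ is the one-dimensional Dirichlet kernel and $K_l(t)=\frac1{l+1}\sum_{r=0}^{l}D_r(t)$ is the one-dimensional Fejér kernel. For $f\in L^1(\mathbb T^\infty)$, $p\in\mathbb N$ and nonnegative integers $N_1,\dots,N_p$, the Fejér mean of $f$ is $$\sigma_{p,N_1,\dots,N_p}(x)=\int_{\mathbb T^\infty}\prod_{j=1}^pK_{N_j}(x_j-t_j)\,f(t)\,dt .$$ (These are the arithmetic means of the rectangular partial sums of the Fourier series of $f$ with respect to the characters $e^{2\pi i(n_1x_1+\dots+n_px_p)}$ of $\mathbb T^\infty$.) Convergence ''in the enhanced sense'' means that for each fixed $p$ the $p$-dimensional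 means converge (here over cubes, i.e. $N_1=\dots=N_p=N\to\infty$), and that the resulting limits converge as $p\to\infty$. *)

(* Defs.v *)
From HB Require Import structures.
From mathcomp Require Import all_boot all_order all_algebra.
From mathcomp Require Import generic_quotient archimedean complex.
From mathcomp Require Import all_classical all_reals all_analysis.
From mathcomp Require Import measurable_realfun ring lra.

Set Implicit Arguments.
Unset Strict Implicit.
Unset Printing Implicit Defensive.
Import Order.TTheory GRing.Theory Num.Theory numFieldNormedType.Exports.

Local Open Scope classical_set_scope.
Local Open Scope ring_scope.
Local Open Scope quotient_scope.
Local Open Scope complex_scope.

Section circle_quotient.
Variable R : realType.

Definition eqmodZ (x y : R) : bool := (x - y) \is a Num.int.

Lemma eqmodZ_refl : reflexive eqmodZ.
Proof. by move=> x; rewrite /eqmodZ subrr rpred0. Qed.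

Lemma eqmodZ_sym : symmetric eqmodZ.
Proof. by move=> x y; rewrite /eqmodZ -rpredN opprB. Qed.

Lemma eqmodZ_trans : transitive eqmodZ.
Proof. by move=> y x z xy yz; rewrite /eqmodZ -(subrKA y) rpredD. Qed.

Canonical eqmodZ_equiv := EquivRel eqmodZ eqmodZ_refl eqmodZ_sym eqmodZ_trans.

Definition circle := {eq_quot eqmodZ_equiv}.
HB.instance Definition _ := Choice.on circle.
HB.instance Definition _ := EqQuotient.on circle.

Definition to_circle (x : measurableTypeR R) : circle := \pi_circle x.

Lemma to_circleE (x y : R) : (to_circle x == to_circle y) = ((x - y) \is a Num.int).
Proof. by rewrite /to_circle eqmodE. Qed.

Lemma to_circle_repr (x : circle) : to_circle (repr x) = x.
Proof. exact: reprK. Qed.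

Definition circle_add (x y : circle) := to_circle (repr x + repr y).
Definition circle_opp (x : circle) := to_circle (- repr x).

Lemma circle_addE (x y : R) : circle_add (to_circle x) (to_circle y) = to_circle (x + y).
Proof.
apply/eqP; rewrite to_circleE opprD addrACA rpredD// -to_circleE;
by rewrite to_circle_repr.
Qed.

Lemma circle_oppE (x : R) : circle_opp (to_circle x) = to_circle (- x).
Proof.
by apply/eqP; rewrite to_circleE -opprD rpredN -to_circleE to_circle_repr.
Qed.

Let addA : associative circle_add.
Proof.
move=> x y z; rewrite -(to_circle_repr x) -(to_circle_repr y) -(to_circle_repr z).
by rewrite !circle_addE addrA.
Qed.

Let addC : commutative circle_add.
Proof. by move=> x y; rewrite /circle_add addrC. Qed.

Let add0 : left_id (to_circle 0) circle_add.
Proof. by move=> x; rewrite -(to_circle_repr x) circle_addE add0r. Qed.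

Let addN : left_inverse (to_circle 0) circle_opp circle_add.
Proof.
by move=> x; rewrite -(to_circle_repr x) circle_oppE circle_addE addNr.
Qed.

HB.instance Definition _ := GRing.isZmodule.Build circle addA addC add0 addN.
HB.instance Definition _ := isPointed.Build circle (0 : circle).

(* The quotient sigma-algebra, which is the Borel sigma-algebra of R/Z. *)
Definition circle_measurable : set (set circle) :=
  [set A | measurable (to_circle @^-1` A)].

Let circle_measurable0 : circle_measurable set0.
Proof. by rewrite /circle_measurable /= preimage_set0. Qed.

Let circle_measurableC A : circle_measurable A -> circle_measurable (~` A).
Proof. by rewrite /circle_measurable /= preimage_setC; exact: measurableC. Qed.

Let circle_measurable_bigcup (F : (set circle)^nat) :
  (forall i, circle_measurable (F i)) -> circle_measurable (\bigcup_i F i).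
Proof.
by move=> mF; rewrite /circle_measurable /= preimage_bigcup; exact: bigcupT_measurable.
Qed.

HB.instance Definition _ := @isMeasurable.Build default_measure_display circle
  circle_measurable circle_measurable0 circle_measurableC circle_measurable_bigcup.

Lemma measurable_to_circle :
  measurable_fun setT to_circle.
Proof. by move=> _ A mA; rewrite setTI. Qed.

HB.instance Definition _ := isMeasurableFun.Build _ _ _ _
  to_circle measurable_to_circle.

Definition circle_measure : probability circle R :=
  distribution (uniform_prob (@ltr01 R)) to_circle.

End circle_quotient.

Section torus.
Variable R : realType.

Definition coordinate_sets : set (set (nat -> circle R)) :=
  \bigcup_n preimage_set_system setT (fun x => x n) measurable.

Definition torus := g_sigma_algebraType coordinate_sets.

Definition cylinder (p : nat) (A : nat -> set (circle R)) : set torus :=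
  [set x : nat -> circle R | forall n, (n < p)%N -> A n (x n)].

Definition is_product_measure (mu : set torus -> \bar R) :=
  forall (p : nat) (A : nat -> set (circle R)),
    (forall n, measurable (A n)) ->
    (mu (cylinder p A) = \prod_(n < p) circle_measure R (A n))%E.

End torus.

(* Existence of the product measure.  Splitting the binary digits of w in [0, 1]
   into odd- and even-ranked ones yields two independent uniform variables;
   iterating the splitting yields a sequence of such variables. *)
Section product_measure_existence.
Variable R : realType.
Notation mR := (measurableTypeR R).
Notation P := (uniform_prob (@ltr01 R)).
Implicit Types (x y w : R) (B : set R).

Lemma uniform_probE B : measurable B -> P B = lebesgue_measure (B `&` `[0, 1]).
Proof.
move=> mB; rewrite /uniform_prob integral_uniform_pdf.
under eq_integral => x.
  rewrite inE => -[_ /=]; rewrite in_itv /= => x01.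
  rewrite /uniform_pdf x01 subr0 invr1; over.
by rewrite integral_cst/= ?mul1e//; exact: measurableI.
Qed.

Definition clip x : R := if x <= 0 then 0 else if x <= 1 then x else 1.

Lemma uniform_prob_lt x : P `]-oo, x[ = (clip x)%:E.
Proof.
rewrite uniform_probE// /clip.
have [x0|x0] := leP x 0.
  rewrite (_ : _ `&` _ = set0) ?measure0; last first.
    by apply/seteqP; split => // y [] /=; rewrite !in_itv /= => ? /andP[]; lra.
  by [].
have [x1|x1] := leP x 1.
  rewrite (_ : _ `&` _ = `[0, x[%classic); last first.
    apply/seteqP; split => y /=; rewrite !in_itv /=.
      by move=> [? /andP[? ?]]; apply/andP; split.
    by move=> /andP[? ?]; split => //; apply/andP; split => //; lra.
  rewrite lebesgue_measure_itv /= lte_fin x0.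
  by rewrite sube0.
rewrite (_ : _ `&` _ = `[0, 1]%classic); last first.
  apply/seteqP; split => y /=; rewrite !in_itv /=; first by case.
  by move=> /andP[? ?]; split; [lra|apply/andP; split].
by rewrite lebesgue_measure_itv /= lte_fin ltr01 sube0.
Qed.

Lemma eq_prob_itv (m1 m2 : {measure set mR -> \bar R}) :
  (m1 setT < +oo)%E ->
  (forall x, m1 `]-oo, x[%classic = m2 `]-oo, x[%classic) ->
  forall B, measurable B -> m1 B = m2 B.
Proof.
move=> m1oo m12 B mB.
apply: (@measure_unique _ R mR (@RGenInftyO.G R) (fun n => `]-oo, n%:R[%classic)) => //.
- exact: RGenInftyO.measurableE.
- move=> _ _ [x ->] [y ->]; exists (Num.min x y).
  apply/seteqP; split => z /=; rewrite !in_itv /= lt_min.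
    by case=> -> ->.
  by case/andP.
- by move=> n; exists n%:R.
- apply/seteqP; split => // x _; exists (Num.truncn `|x|).+1 => //=.
  rewrite in_itv /=; apply: le_lt_trans (ler_norm x) _.
  exact: truncnS_gt.
- by move=> _ [x ->].
- by move=> k; apply: le_lt_trans m1oo; apply: le_measure; rewrite ?inE.
Qed.

Definition dbl w : R := if w < 2^-1 then 2 * w else 2 * w - 1.
Definition bit w : R := if w < 2^-1 then 0 else 1.

Lemma measurable_dbl : measurable_fun setT dbl.
Proof.
apply: measurable_fun_ifT => /=.
- exact: measurable_fun_ltr.
- exact: measurable_funM.
- by apply: measurable_funB => //; exact: measurable_funM.
Qed.

Lemma measurable_bit : measurable_fun setT bit.
Proof. by apply: measurable_fun_ifT => //=; exact: measurable_fun_ltr. Qed.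


Lemma clip_half x : clip x = 2^-1 * clip (2 * x) + 2^-1 * clip (2 * x - 1).
Proof.
by rewrite /clip; repeat (case: leP => ?); lra.
Qed.

Definition image_measure d (T : measurableType d) (m : {measure set mR -> \bar R})
  (f : mR -> T) (mf : measurable_fun setT f) : {measure set T -> \bar R} :=
  measure_function_pushforward__canonical__measure_function_Measure m mf.

Lemma uniform_prob_co x y : x <= y ->
  P `[x, y[ = (clip y - clip x)%:E.
Proof.
move=> xy; rewrite (_ : [set` _] = `]-oo, y[ `\` `]-oo, x[); last first.
  apply/seteqP; split => z /=; rewrite !in_itv/=.
    by move=> /andP[? ?]; split => //; apply/negP; rewrite -leNgt.
  by move=> [? /negP]; rewrite -leNgt => ?; apply/andP.
rewrite measureD//= ?uniform_prob_lt; last by rewrite ltry.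
rewrite setIidr ?uniform_prob_lt// => z /=; rewrite !in_itv/= => zx.
exact: lt_le_trans zx xy.
Qed.

Lemma uniform_dbl_lo B : measurable B ->
  P ([set w | w < 2^-1] `&` (fun w => 2 * w) @^-1` B) = (2^-1%:E * P B)%E.
Proof.
have mlt : measurable [set w : R | w < 2^-1].
  by rewrite (_ : mkset _ = `]-oo, 2^-1[%classic)//; apply/seteqP.
have mf : measurable_fun setT ((fun w : R => 2 * w) : mR -> mR) by exact: measurable_funM.
have h0 : (0 <= 2^-1 :> R)%R by lra.
move=> mB; rewrite setIC.
apply: (@eq_prob_itv (image_measure (mrestr P (mlt : measurable (_ : set mR))) mf)
  (mscale (NngNum h0) P) _ _ B mB) => [|x].
  rewrite /= /pushforward /mrestr.
  apply: le_lt_trans (probability_le1 _ _) _; last by rewrite ltry.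
  by rewrite preimage_setT setTI; exact: mlt.
rewrite /= /pushforward /mrestr /mscale /= [RHS]/= uniform_prob_lt.
rewrite (_ : _ `&` _ = `]-oo, (Num.min 2^-1 (2^-1 * x))[%classic); last first.
  apply/seteqP; split => z /=; rewrite !in_itv/= lt_min.
    by move=> [? ?]; apply/andP; split; lra.
  by move=> /andP[? ?]; split => //; lra.
rewrite uniform_prob_lt -EFinM /clip; congr (_%:E).
by case: (leP 2^-1 (2^-1 * x)) => ?; repeat (case: leP => ?); lra.
Qed.

Lemma uniform_dbl_hi B : measurable B ->
  P ([set w | 2^-1 <= w] `&` (fun w => 2 * w - 1) @^-1` B) = (2^-1%:E * P B)%E.
Proof.
have mlt : measurable [set w : R | 2^-1 <= w].
  rewrite (_ : mkset _ = `[2^-1, +oo[%classic)//; apply/seteqP.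
  by split => z /=; rewrite in_itv /= andbT.
have mf : measurable_fun setT ((fun w : R => 2 * w - 1) : mR -> mR).
  by apply: measurable_funB => //; exact: measurable_funM.
have h0 : (0 <= 2^-1 :> R)%R by lra.
move=> mB; rewrite setIC.
apply: (@eq_prob_itv (image_measure (mrestr P (mlt : measurable (_ : set mR))) mf)
  (mscale (NngNum h0) P) _ _ B mB) => [|x].
  rewrite /= /pushforward /mrestr.
  apply: le_lt_trans (probability_le1 _ _) _; last by rewrite ltry.
  by rewrite preimage_setT setTI; exact: mlt.
rewrite /= /pushforward /mrestr /mscale /= [RHS]/= uniform_prob_lt.
rewrite (_ : _ `&` _ = `[2^-1, (Num.max 2^-1 (2^-1 * x + 2^-1))[%classic); last first.
  apply/seteqP; split => z /=; rewrite !in_itv/= lt_max.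
    by move=> [? ->]; rewrite /=; apply/orP; right; lra.
  by move=> /andP[? /orP[?|?]]; split => //; lra.
rewrite uniform_prob_co; last by rewrite le_max lexx.
rewrite -EFinM /clip; congr (_%:E).
by case: (leP 2^-1 (2^-1 * x + 2^-1)) => ?; repeat (case: leP => ?); lra.
Qed.

Fixpoint odd_digits_approx n w : R :=
  if n is n'.+1 then 2^-1 * (bit w + odd_digits_approx n' (dbl (dbl w))) else 0.

Lemma odd_digits_approx_ge0 n w : 0 <= odd_digits_approx n w.
Proof. by elim: n w => //= n ih w; have := ih (dbl (dbl w)); rewrite /bit; case: ifP => ?; lra. Qed.

Lemma odd_digits_approx_le1 n w : odd_digits_approx n w <= 1.
Proof. by elim: n w => //= n ih w; have := ih (dbl (dbl w)); rewrite /bit; case: ifP => ?; lra. Qed.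

Lemma odd_digits_approx_nd w : nondecreasing_seq (odd_digits_approx ^~ w).
Proof.
apply/nondecreasing_seqP => n; elim: n w => [|n ih] w.
  exact: odd_digits_approx_ge0.
by have /= := ih (dbl (dbl w)); lra.
Qed.

Lemma measurable_odd_digits_approx n : measurable_fun setT (odd_digits_approx n).
Proof.
elim: n => [|n ih] /=; first exact: measurable_cst.
apply: measurable_funM => //; apply: measurable_funD; first exact: measurable_bit.
apply: (measurableT_comp ih).
by apply: measurableT_comp => //; exact: measurable_dbl.
Qed.

Definition odd_digits w := limn (odd_digits_approx ^~ w).
Definition even_digits w := odd_digits (dbl w).

Lemma odd_digits_cvg w : odd_digits_approx ^~ w @ \oo --> odd_digits w.
Proof.
apply: nondecreasing_is_cvgn; first exact: odd_digits_approx_nd.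
by exists 1 => _ [n _ <-]; exact: odd_digits_approx_le1.
Qed.

Lemma measurable_odd_digits : measurable_fun setT odd_digits.
Proof.
apply: (measurable_fun_cvg measurable_odd_digits_approx) => x _.
exact: odd_digits_cvg.
Qed.

Lemma measurable_even_digits : measurable_fun setT even_digits.
Proof. exact: (measurableT_comp measurable_odd_digits measurable_dbl). Qed.

Lemma odd_digits_ge0 w : 0 <= odd_digits w.
Proof. by apply: limr_ge; [exact: odd_digits_cvg|apply: nearW => n; exact: odd_digits_approx_ge0]. Qed.

Lemma odd_digits_le1 w : odd_digits w <= 1.
Proof. by apply: limr_le; [exact: odd_digits_cvg|apply: nearW => n; exact: odd_digits_approx_le1]. Qed.

Lemma odd_digitsE w : odd_digits w = 2^-1 * (bit w + even_digits (dbl w)).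
Proof.
apply/cvg_lim => //; rewrite -(cvg_shiftS (odd_digits_approx ^~ w)) /=.
apply: cvgMr; apply: cvgD; first exact: cvg_cst.
exact: odd_digits_cvg.
Qed.


Let oddm := measurable_odd_digits.
Let evenm := measurable_even_digits.

Lemma measurable_odd_even A B : measurable A -> measurable B ->
  measurable (odd_digits @^-1` A `&` even_digits @^-1` B).
Proof.
by move=> mA mB; apply: measurableI; rewrite -[X in measurable X]setTI;
  [exact: oddm|exact: evenm].
Qed.

Definition cdf2 x y := fine (P (odd_digits @^-1` `]-oo, x[ `&` even_digits @^-1` `]-oo, y[)).

Lemma cdf2E x y :
  P (odd_digits @^-1` `]-oo, x[ `&` even_digits @^-1` `]-oo, y[) = (cdf2 x y)%:E.
Proof.
rewrite /cdf2 fineK// ge0_fin_numE ?measure_ge0//.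
by apply: le_lt_trans (probability_le1 _ _) _; rewrite ?ltry//; exact: measurable_odd_even.
Qed.

Lemma cdf2_half x y : cdf2 x y = 2^-1 * cdf2 y (2 * x) + 2^-1 * cdf2 y (2 * x - 1).
Proof.
apply: EFin_inj; rewrite EFinD !EFinM -!cdf2E.
rewrite -uniform_dbl_lo; last exact: measurable_odd_even.
rewrite -uniform_dbl_hi; last exact: measurable_odd_even.
rewrite -measureU //=; last 3 first.
- apply: measurableI.
    rewrite (_ : mkset _ = `]-oo, 2^-1[%classic)//; exact/seteqP.
  rewrite -[X in measurable X]setTI.
  have : measurable_fun setT (fun w : R => 2 * w) by exact: measurable_funM.
  by apply => //; exact: measurable_odd_even.
- apply: measurableI.
    rewrite (_ : mkset _ = `[2^-1, +oo[%classic)//; apply/seteqP.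
    by split => z /=; rewrite in_itv /= andbT.
  rewrite -[X in measurable X]setTI.
  have : measurable_fun setT (fun w : R => 2 * w - 1).
    by apply: measurable_funB => //; exact: measurable_funM.
  by apply => //; exact: measurable_odd_even.
- by apply/seteqP; split => // w /= [[? _] [? _]]; lra.
congr (P _); apply/seteqP; split => w /=; rewrite !in_itv /= (odd_digitsE w) /bit /even_digits /dbl.
  by case: (ltP w 2^-1) => ? [? ?]; [left|right]; repeat split => //; lra.
by move=> [|] [w2 [? ?]]; case: (ltP w 2^-1) => ?; split => //; lra.
Qed.

Lemma contract0 (T : Type) (h : T -> R) :
  (forall t, `|h t| <= 1) -> (forall t, exists t', `|h t| <= 2^-1 * `|h t'|) ->
  forall t, h t = 0.
Proof.
move=> h1 h2 t; have hn n : forall s, `|h s| <= 2^-1 ^+ n.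
  elim: n => [s|n ih s]; first by rewrite expr0.
  have [s' hs'] := h2 s; rewrite exprS; apply: le_trans hs' _.
  by rewrite ler_pM2l ?ih//; lra.
apply/eqP; rewrite -normr_le0.
have /cvgr_to_ge : (GRing.exp (2^-1 : R) : R ^nat) @ \oo --> 0.
  by apply: cvg_expr; rewrite ger0_norm; lra.
by apply; apply: nearW => n; exact: hn.
Qed.

Lemma cdf2_ge0 x y : 0 <= cdf2 x y.
Proof. by rewrite fine_ge0. Qed.

Lemma cdf2_le1 x y : cdf2 x y <= 1.
Proof.
rewrite -lee_fin -cdf2E; apply: probability_le1; exact: measurable_odd_even.
Qed.

Lemma cdf2_0 x y : (x <= 0) || (y <= 0) -> cdf2 x y = 0.
Proof.
move=> xy0; apply: EFin_inj; rewrite -cdf2E (_ : _ `&` _ = set0) ?measure0//.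
apply/seteqP; split => // w /=; rewrite !in_itv /= => -[].
have := odd_digits_ge0 w; have : 0 <= even_digits w by exact: odd_digits_ge0.
by move: xy0 => /orP[]; lra.
Qed.

Lemma cdf2_1r x y : 1 < y -> cdf2 x y = cdf2 x 2.
Proof.
move=> y1; congr (fine (P (_ `&` _))); apply/seteqP; split => w /= _;
by rewrite in_itv /= (le_lt_trans (odd_digits_le1 _))//; lra.
Qed.

Lemma cdf2_1l x y : 1 < x -> cdf2 x y = cdf2 y 2.
Proof.
move=> x1; rewrite cdf2_half.
have -> : cdf2 y (2 * x) = cdf2 y 2 by apply: cdf2_1r; lra.
have -> : cdf2 y (2 * x - 1) = cdf2 y 2 by apply: cdf2_1r; lra.
lra.
Qed.

Lemma cdf2_22 : cdf2 2 2 = 1.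
Proof.
apply: EFin_inj; rewrite -cdf2E -[RHS](@probability_setT _ _ _ P); congr (P _).
apply/seteqP; split => // w _ /=; rewrite !in_itv /=.
by split; rewrite (le_lt_trans (odd_digits_le1 _))//; lra.
Qed.

Lemma clip_itv x : 0 <= clip x <= 1.
Proof. by rewrite /clip; case: (leP x 0) => ?; case: (leP x 1) => ?; apply/andP; split; lra. Qed.

Lemma clip1 x : 1 < x -> clip x = 1.
Proof. by rewrite /clip => x1; case: (leP x 0) => ?; case: (leP x 1) => ?; lra. Qed.

Lemma norm_half (x : R) : `|2^-1 * x| <= 2^-1 * `|x|.
Proof. by rewrite normrM ger0_norm. Qed.

Lemma cdf2_marginal x : cdf2 x 2 = clip x.
Proof.
apply/eqP; rewrite -subr_eq0; apply/eqP.
apply: (@contract0 _ (fun x => cdf2 x 2 - clip x)) => {x} x.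
  have := cdf2_ge0 x 2; have := cdf2_le1 x 2; have /andP[] := clip_itv x.
  by move=> *; rewrite ler_norml; apply/andP; split; lra.
have h2 z : cdf2 2 z = cdf2 z 2 by apply: cdf2_1l; lra.
rewrite cdf2_half !h2 clip_half.
have [x2|x2] := leP x 2^-1.
  exists (2 * x); have x0 : 2 * x - 1 <= 0 by lra.
  have -> : cdf2 (2 * x - 1) 2 = 0 by apply: cdf2_0; rewrite x0.
  have -> : clip (2 * x - 1) = 0 by rewrite /clip x0.
  by rewrite !mulr0 !addr0 -mulrBr norm_half.
exists (2 * x - 1); have x1 : 1 < 2 * x by lra.
have -> : cdf2 (2 * x) 2 = 1 by rewrite -h2 (cdf2_1r _ x1) cdf2_22.
have -> : clip (2 * x) = 1 by apply: clip1; exact: x1.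
by rewrite opprD addrACA subrr add0r -mulrBr norm_half.
Qed.

Lemma cdf2_prod x y : cdf2 x y = clip x * clip y.
Proof.
apply/eqP; rewrite -subr_eq0; apply/eqP.
apply: (@contract0 _ (fun z => cdf2 z.1 z.2 - clip z.1 * clip z.2) _ _ (x, y))
  => {x y} -[x y] /=.
  have := cdf2_ge0 x y; have := cdf2_le1 x y; have /andP[] := clip_itv x.
  have /andP[] := clip_itv y.
  by move=> *; rewrite ler_norml; apply/andP; split; nra.
rewrite cdf2_half clip_half.
have [x2|x2] := leP x 2^-1.
  exists (y, 2 * x) => /=; have x0 : 2 * x - 1 <= 0 by lra.
  have -> : cdf2 y (2 * x - 1) = 0 by apply: cdf2_0; rewrite x0 orbT.
  have -> : clip (2 * x - 1) = 0 by rewrite /clip x0.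
  by rewrite !mulr0 !addr0 -mulrA -mulrBr [clip y * _]mulrC norm_half.
exists (y, 2 * x - 1) => /=; have x1 : 1 < 2 * x by lra.
have -> : cdf2 y (2 * x) = clip y by rewrite (cdf2_1r _ x1) cdf2_marginal.
have -> : clip (2 * x) = 1 by apply: clip1; exact: x1.
by rewrite mulr1 [(_ + _) * clip y]mulrDl opprD addrACA subrr add0r -mulrA -mulrBr [clip y * _]mulrC norm_half.
Qed.

Lemma odd_even_indep A B : measurable A -> measurable B ->
  P (odd_digits @^-1` A `&` even_digits @^-1` B) = (P A * P B)%E.
Proof.
have fP C : measurable C -> P C \is a fin_num by move=> mC; exact: fin_num_measure.
have ltP1 C : (measurable C -> P C <= 1)%E by exact: probability_le1.
have oddm' : measurable_fun setT (odd_digits : mR -> mR) by [].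
have evenm' : measurable_fun setT (even_digits : mR -> mR) by [].
have step1 x B' : measurable B' ->
    P (odd_digits @^-1` `]-oo, x[ `&` even_digits @^-1` B') = (P `]-oo, x[ * P B')%E.
  have mx : measurable (odd_digits @^-1` `]-oo, x[ : set mR).
    by rewrite -[X in measurable X]setTI; exact: oddm.
  have cx : 0 <= clip x by have /andP[] := clip_itv x.
  move=> mB'; rewrite setIC uniform_prob_lt.
  apply: (@eq_prob_itv (image_measure (mrestr P mx) evenm')
    (mscale (NngNum cx) P) _ _ B' mB') => [|y].
    apply: le_lt_trans (probability_le1 _ _) _; last by rewrite ltry.
    by rewrite preimage_setT setTI; exact: mx.
  rewrite /= /pushforward /mrestr /mscale /= [RHS]/= setIC.
  by rewrite cdf2E uniform_prob_lt -EFinM cdf2_prod.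
move=> mA mB.
have mB2 : measurable (even_digits @^-1` B : set mR).
  by rewrite -[X in measurable X]setTI; exact: evenm.
have cB : 0 <= fine (P B) by rewrite fine_ge0.
rewrite muleC -(fineK (fP _ mB)).
apply: (@eq_prob_itv (image_measure (mrestr P mB2) oddm')
  (mscale (NngNum cB) P) _ _ A mA) => [|x].
  apply: le_lt_trans (probability_le1 _ _) _; last by rewrite ltry.
  by rewrite preimage_setT setTI; exact: mB2.
rewrite /= /pushforward /mrestr /mscale /= [RHS]/=.
by rewrite step1// muleC fineK// fP.
Qed.

Definition digits_torus (w : mR) : torus R :=
  fun n => to_circle (odd_digits (iter n even_digits w)).

Lemma measurable_iter_even n : measurable_fun setT (iter n even_digits : mR -> mR).
Proof.
elim: n => [|n ih] /=; first exact: measurable_id.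
exact: (measurableT_comp (measurable_even_digits : measurable_fun setT (even_digits : mR -> mR)) ih).
Qed.

Lemma measurable_digits n :
  measurable_fun setT (fun w : mR => digits_torus w n).
Proof.
apply: measurableT_comp; first exact: measurable_to_circle.
exact: (measurableT_comp (measurable_odd_digits : measurable_fun setT (odd_digits : mR -> mR))
  (measurable_iter_even n)).
Qed.

Lemma measurable_digits_torus : measurable_fun setT digits_torus.
Proof.
apply: (@measurability _ _ mR (torus R) setT digits_torus
  (@coordinate_sets R)) => //.
move=> _ [_ [n _ [A mA <-]] <-]; rewrite !setTI.
by have := @measurable_digits n measurableT A mA; rewrite setTI.
Qed.

HB.instance Definition _ := isMeasurableFun.Build _ _ _ _
  digits_torus measurable_digits_torus.

Lemma digits_cylinder p (A : nat -> set (circle R)) :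
  (forall n, measurable (A n)) ->
  measurable (digits_torus @^-1` cylinder p A : set mR) /\
  (P (digits_torus @^-1` cylinder p A) = \prod_(n < p) circle_measure R (A n))%E.
Proof.
elim: p A => [|p ih] A mA.
  rewrite big_ord0 (_ : _ @^-1` _ = setT) ?probability_setT; first by split.
  by apply/seteqP; split.
have [mC PC] := ih (fun n => A n.+1) (fun n => mA n.+1).
have mA0 : measurable (@to_circle R @^-1` A 0%N) by have := mA 0%N.
have -> : digits_torus @^-1` cylinder p.+1 A =
    odd_digits @^-1` (@to_circle R @^-1` A 0%N) `&`
    even_digits @^-1` (digits_torus @^-1` cylinder p (fun n => A n.+1)).
  apply/seteqP; split => w /=.
    move=> h; split; first exact: (h 0%N).
    by move=> n np; have := h n.+1 np; rewrite /digits_torus iterSr.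
  move=> [h0 h] [|n] np; first exact: h0.
  by have := h n np; rewrite /digits_torus iterSr.
split; first exact: measurable_odd_even.
by rewrite odd_even_indep// PC big_ord_recl.
Qed.

Lemma product_measure_exists :
  exists mu : probability (torus R) R, is_product_measure mu.
Proof.
exists (distribution P digits_torus) => p A mA.
by have [] := digits_cylinder p mA.
Qed.

End product_measure_existence.

Section product_measure_uniqueness.
Variable R : realType.

Lemma measurable_coordinate n : measurable_fun setT (fun x : torus R => x n).
Proof.
move=> _ A mA; rewrite setTI; apply: sub_sigma_algebra.
by exists n => //; exists A => //; rewrite setTI.
Qed.

Lemma measurable_cylinder p (A : nat -> set (circle R)) :
  (forall n, measurable (A n)) -> measurable (cylinder p A).
Proof.
move=> mA; rewrite (_ : cylinder p A =
    \bigcap_(n in `I_p) ((fun x : torus R => x n) @^-1` A n))//.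
apply: bigcap_measurableType => n np; rewrite -[X in measurable X]setTI.
exact: measurable_coordinate.
Qed.

Lemma cylinderI p q (A B : nat -> set (circle R)) :
  cylinder p A `&` cylinder q B =
  cylinder (maxn p q) (fun n => (if (n < p)%N then A n else setT) `&`
                                (if (n < q)%N then B n else setT)).
Proof.
apply/seteqP; split => x /=.
  by move=> [xA xB] n _; split; case: ifPn => // np; [exact: xA|exact: xB].
move=> xAB; split => n np; have := xAB n.
  by rewrite leq_max np /= => /(_ isT)[].
by rewrite leq_max np orbT /= => /(_ isT)[].
Qed.

Lemma product_measure_unique (mu nu : probability (torus R) R) :
  is_product_measure mu -> is_product_measure nu ->
  forall E, measurable E -> mu E = nu E.
Proof.
move=> muP nuP E mE.
pose G : set (set (torus R)) := [set C | exists p A,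
  (forall n, measurable (A n)) /\ C = cylinder p A].
apply: (@measure_unique _ R (torus R) G (fun=> setT)) => //.
- apply/seteqP; split.
    apply: smallest_sub; first exact: smallest_sigma_algebra.
    move=> _ [n _ [A mA <-]]; apply: sub_sigma_algebra.
    exists n.+1, (fun k => if k == n then A else setT); split.
      by move=> k; case: ifP.
    rewrite setTI; apply/seteqP; split => x /= xA.
      by move=> k _; case: eqP => // ->.
    by have := xA n (ltnSn n); rewrite eqxx.
  apply: smallest_sub; first exact: sigma_algebra_measurable.
  by move=> _ [p [A [mA ->]]]; exact: measurable_cylinder.
- move=> _ _ [p [A [mA ->]]] [q [B [mB ->]]]; rewrite cylinderI.
  eexists; eexists; split; last reflexivity.
  by move=> n; apply: measurableI; case: ifP.
- move=> _; exists 0%N, (fun=> setT); split => //.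
  by apply/seteqP; split.
- by apply/seteqP; split => // x _; exists 0%N.
- by move=> _ [p [A [mA ->]]]; exact: etrans (muP _ _ mA) (esym (nuP _ _ mA)).
- by move=> _; rewrite /= probability_setT ltry.
Qed.

End product_measure_uniqueness.

Definition torus_measure (R : realType) : probability (torus R) R :=
  projT1 (cid (@product_measure_exists R)).

Lemma torus_measureP (R : realType) : is_product_measure (torus_measure R).
Proof. exact: projT2 (cid (@product_measure_exists R)). Qed.

Section complex_integration.
Context {R : realType} {d : measure_display} {T : measurableType d}.
Variable mu : {measure set T -> \bar R}.
Implicit Types f : T -> R[i].

Definition cintegrable f :=
  mu.-integrable setT (fun t => (complex.Re (f t))%:E) /\
  mu.-integrable setT (fun t => (complex.Im (f t))%:E).

Definition cintegral f : R[i] :=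
  (\int[mu]_t complex.Re (f t)) +i* (\int[mu]_t complex.Im (f t)).

End complex_integration.

Section fejer.
Variable R : realType.

(* e^(2 pi i j t); see [circle_charE] for the independence of the
   representative. *)
Definition circle_char (j : int) (t : circle R) : R[i] :=
  cos (2 * pi * j%:~R * repr t) +i* sin (2 * pi * j%:~R * repr t).

Lemma circle_charE (j : int) (x : R) : circle_char j (to_circle x) =
  cos (2 * pi * j%:~R * x) +i* sin (2 * pi * j%:~R * x).
Proof.
have : to_circle (repr (to_circle x)) == to_circle x.
  by rewrite to_circle_repr.
rewrite to_circleE /circle_char => /intrP[m mE].
rewrite (_ : repr _ = x + m%:~R); last by rewrite -mE addrC subrK.
rewrite (_ : _ * (x + _) = 2 * pi * j%:~R * x + (j * m)%:~R * (pi *+ 2)); last first.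
  by rewrite intrM -mulr_natl; ring.
have per k (a : R) : ((cos (a + k%:R * (pi *+ 2)) = cos a) *
                     (sin (a + k%:R * (pi *+ 2)) = sin a))%type.
  by split; rewrite mulr_natl periodicn//; [exact: cosD2pi|exact: sinD2pi].
case: (j * m) => k.
  by rewrite !per.
have [] := per k.+1 (2 * pi * j%:~R * x + (Negz k)%:~R * (pi *+ 2)).
by rewrite NegzE mulrNz mulNr subrK => <- <-.
Qed.

Definition dirichlet_kernel (l : nat) (t : circle R) : R[i] :=
  \sum_(k < (2 * l)%N.+1) circle_char (k%:Z - l%:Z) t.

Definition fejer_kernel (l : nat) (t : circle R) : R[i] :=
  l.+1%:R^-1 * \sum_(r < l.+1) dirichlet_kernel r t.

Definition fejer_mean (f : torus R -> R[i]) (p : nat) (N : 'I_p -> nat)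
    (x : torus R) : R[i] :=
  cintegral (torus_measure R)
    (fun t : torus R => (\prod_(j < p) fejer_kernel (N j) (x j - t j)) * f t).

End fejer.

(* Main.v *)
From HB Require Import structures.
Require Import Defs.
From mathcomp Require Import all_boot all_order all_algebra complex.
From mathcomp Require Import all_classical all_reals all_analysis.
From mathcomp Require Import measurable_realfun ring lra zify.
Set Implicit Arguments.
Unset Strict Implicit.
Unset Printing Implicit Defensive.
Import Order.TTheory GRing.Theory Num.Theory numFieldNormedType.Exports.
Local Open Scope classical_set_scope.
Local Open Scope ring_scope.
Local Open Scope complex_scope.

(** The averages of an integrable [u] over dyadic cubes of level [n] in the first [p]
    coordinates are means of [u] against a product kernel, just as its Fejér means are
    ([pmean], with [cell_kernel] and [fejer_re]). Call [u] [ae_convergent] if, at almost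
    every point, both means have for each [p] a common limit [s p], as the order or the
    level tends to infinity, and [s p] tends to [u]. Applied to the real and imaginary
    parts of [f], the theorem says that every integrable [u] has this property
    ([ae_convergent_L1]).

    This holds for the indicator of a cylinder whose sides are unions of dyadic arcs
    ([ae_convergent_cylinder]): its means are products of means in one coordinate, and
    in one coordinate both kernels are approximate identities at every point off the
    dyadic grid. The property is linear and is preserved by limits in the mean
    ([ae_convergent_closed]), so by Dynkin's theorem it extends to indicators of all
    measurable sets, then to simple functions and to all integrable functions.

    Preservation by limits is Banach's principle: what holds for functions close to [u]
    in the mean holds for [u] as soon as the relevant maximal function of a function
    [w] exceeds [lam] only on a set of measure at most a constant times the norm of [w]
    over [lam]. There are two such bounds, and both follow from the maximal inequality
    for nested countable partitions ([martingale_maximal_inequality]).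

    For fixed [p], the constant may depend on [p] ([fejer_maximal]). With [2 ^ n] of the
    order of [N], the kernel [K_N] is at most a constant times the sum over [a <= n] of
    [2 ^- a] times normalized indicators of the cells of level [n - a], taken from the
    dyadic grid and from its translate by one third: two points at distance less than
    [1 / (3 * 2 ^ l)] share a cell of level [l] in one of the two grids
    ([one_third_trick]). The product over the [p] coordinates thus becomes a sum of
    averages over boxes; those with given offsets [a] are nested as [n] grows, and the
    geometric weights make the weak-type bounds summable.

    For [p] tending to infinity the constant must not depend on [p]
    ([limit_means_maximal]). The dyadic averages of a fixed level [n] form a martingale
    in [p], so their maximal function satisfies the bound with constant one, uniformly in
    [n], and the bound passes to the limits [s p]. *)

(** * Measure-theoretic preliminaries *)

Lemma inv_succ_le (R : realType) (e : R) : 0 < e -> exists k, k.+1%:R^-1 <= e.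
Proof.
by move=> e0; exists (Num.truncn e^-1); rewrite invf_ple ?posrE//; exact/ltW/truncnS_gt.
Qed.

Section measure_preliminaries.
Context d (T : measurableType d) (R : realType) (m : {measure set T -> \bar R}).
Notation L1 u := (m.-integrable setT (EFin \o u)).
Implicit Types (u v w : T -> R).

Lemma L1_norm u : L1 u -> L1 (fun t => `|u t|).
Proof.
move=> iu; apply: (le_integrable measurableT _ _ iu).
  by apply/measurable_EFinP/measurableT_comp => //; apply/measurable_EFinP; exact: (measurable_int m).
by move=> t _ /=; rewrite normr_id.
Qed.

Lemma L1B u v : L1 u -> L1 v -> L1 (fun t => u t - v t).
Proof. by move=> iu iv; exact: (integrableB measurableT iu iv). Qed.

Lemma Rintegral_bigsum (I : Type) (s : seq I) (F : I -> T -> R) : (forall i, L1 (F i)) ->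
  L1 (fun t => \sum_(i <- s) F i t) /\
  \int[m]_t (\sum_(i <- s) F i t) = \sum_(i <- s) \int[m]_t F i t.
Proof.
move=> iF; elim: s => [|i s [ih1 ih2]].
  rewrite big_nil (_ : (fun t => _) = cst 0); last by apply/funext => t; rewrite big_nil.
  split; first exact: integrable0.
  by rewrite Rintegral_cst// mul0r.
rewrite big_cons (_ : (fun t => _) = (fun t => F i t + \sum_(i <- s) F i t)); last first.
  by apply/funext => t; rewrite big_cons.
split; first exact: (integrableD measurableT (iF i) ih1).
by rewrite RintegralD// ih2.
Qed.

Lemma L1_markov w (lam : R) : L1 w -> 0 < lam ->
  exists B, [/\ measurable B, (lam%:E * m B <= \int[m]_t `|w t|%:E)%E &
    forall x, ~ B x -> `|w x| <= lam].
Proof.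
move=> iw lam0; have mw := measurable_int m iw.
exists (setT `&` [set x | (lam%:E <= `|(w x)%:E|)%E]); split.
- by apply: emeasurable_fun_c_infty => //; exact: measurableT_comp.
- exact: (@le_integral_comp_abse _ _ _ m _ measurableT _ _ id).
- move=> x nB; rewrite leNgt; apply/negP => h; apply: nB; split => //=.
  by rewrite lee_fin ltW.
Qed.

Lemma measure_le_div (B : set T) (lam K eta : R) w : 0 < lam -> 0 <= K ->
  (lam%:E * m B <= K%:E * \int[m]_t `|w t|%:E)%E ->
  (\int[m]_t `|w t|%:E <= eta%:E)%E -> (m B <= (K * eta / lam)%:E)%E.
Proof.
move=> lam0 K0; rewrite -lee_pdivlMl// => h1 h2; apply: (le_trans h1).
rewrite mulrC EFinM; apply: lee_wpmul2l; first by rewrite lee_fin invr_ge0 ltW.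
by rewrite EFinM; apply: lee_wpmul2l.
Qed.

(** The exceptional null set [N] may depend on [e]; this is the form in which a
    maximal inequality applied to small remainders is exploited. *)
Lemma negligible_small (X : set T) :
  (forall e : R, 0 < e -> exists B N, [/\ measurable B, (m B <= e%:E)%E,
    m.-negligible N & X `<=` B `|` N]) -> m.-negligible X.
Proof.
move=> h.
have /choice[B hB] : forall k, exists B, [/\ measurable B, (m B <= (k.+1%:R^-1)%:E)%E & X `<=` B].
  move=> k; have [|B [N [mB lB [N' [mN' N'0 NN']] XB]]] := h k.+1%:R^-1.
    by rewrite invr_gt0.
  exists (B `|` N'); split; first exact: measurableU.
    apply: (le_trans (measureU2 _ mB mN')).
    by rewrite [X in (_ + X)%E]N'0 adde0.
  by apply: (subset_trans XB); exact: setUS.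
have mI : measurable (\bigcap_k B k).
  by apply: bigcap_measurableType => // k _; have [] := hB k.
exists (\bigcap_k B k); split => //; last by move=> x Xx k _; have [_ _] := hB k; apply.
apply/eqP; rewrite eq_le measure_ge0 andbT; apply/lee_addgt0Pr => e e0; rewrite add0e.
have [k ke] := inv_succ_le e0.
have [mBk lBk _] := hB k.
apply: (@le_trans _ _ (m (B k))).
  by apply: le_measure; rewrite ?inE// => x; apply.
by apply: (le_trans lBk); rewrite lee_fin.
Qed.

Lemma measure_bigsetU_le (I : Type) (s : seq I) (B : I -> set T) :
  (forall i, measurable (B i)) ->
  measurable (\big[setU/set0]_(i <- s) B i) /\
  (m (\big[setU/set0]_(i <- s) B i) <= \sum_(i <- s) m (B i))%E.
Proof.
move=> mB; elim: s => [|i s [ih1 ih2]]; first by rewrite !big_nil measure0.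
rewrite !big_cons; split; first exact: measurableU.
by apply: (le_trans (measureU2 _ (mB i) ih1)); rewrite leeD2l.
Qed.

Lemma measure_bigcup_le (F : (set T)^nat) (K : \bar R) : (forall n, measurable (F n)) ->
  nondecreasing_seq F -> (forall n, m (F n) <= K)%E -> (m (\bigcup_n F n) <= K)%E.
Proof.
move=> mF ndF FK; have mU : measurable (\bigcup_n F n) by apply: bigcupT_measurable.
have Fc : (m \o F) x @[x --> \oo] --> m (\bigcup_n F n) := nondecreasing_cvg_mu mF mU ndF.
rewrite -(cvg_lim _ Fc)//; apply: lime_le; last by apply: nearW.
by apply/cvg_ex; eexists; exact: Fc.
Qed.

End measure_preliminaries.

Lemma bounded_integrable d (T : measurableType d) (R : realType)
    (m : {finite_measure set T -> \bar R}) (h : T -> R) (M : R) :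
  measurable_fun setT h -> (forall x, `|h x| <= M) -> m.-integrable setT (EFin \o h).
Proof.
move=> mh hM; apply: (le_integrable measurableT _ _ (finite_measure_integrable_cst m M measurableT)).
  exact/measurable_EFinP.
by move=> x _ /=; rewrite lee_fin (le_trans (hM x))// ler_norm.
Qed.

(** * The Fejér kernel as a function of a real variable *)

Section one_dimensional_kernel.
Variable R : realType.
Implicit Types (y s : R) (l N : nat).

(** The Dirichlet kernel with the characters of opposite frequencies paired, which
    shows that it is real. *)
Fixpoint dirichlet_cos l y : R :=
  if l is l'.+1 then dirichlet_cos l' y + 2 * cos (2 * pi * l'.+1%:R * y) else 1.

Definition fejer_cos N y : R := N.+1%:R^-1 * \sum_(r < N.+1) dirichlet_cos r y.

Lemma dirichlet_kernelE l y : dirichlet_kernel l (to_circle y) = (dirichlet_cos l y)%:C.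
Proof.
elim: l => [|l ih].
  rewrite /dirichlet_kernel big_ord1 circle_charE /= subrr.
  by rewrite !mulr0 mul0r cos0 sin0.
rewrite /dirichlet_kernel mulnS addSn add1n big_ord_recl big_ord_recr /=.
rewrite (eq_bigr (fun k : 'I_(2 * l).+1 => circle_char (k%:Z - l%:Z) (to_circle y))); last first.
  move=> k _; congr (circle_char _ _).
  by rewrite /bump /=; lia.
rewrite -/(dirichlet_kernel l (to_circle y)) ih !circle_charE.
have -> : (2 * pi * (0%:Z - l.+1%:Z)%:~R * y : R) = - (2 * pi * l.+1%:R * y).
  by rewrite sub0r mulrNz pmulrn; ring.
have -> : (2 * pi * ((bump 0 (2 * l).+1)%:Z - l.+1%:Z)%:~R * y : R) = 2 * pi * l.+1%:R * y.
  rewrite (_ : _%:Z - _ = l.+1%:Z) ?pmulrn //.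
  by rewrite /bump /=; lia.
rewrite cosN sinN /=; apply/eqP; rewrite eq_complex /=; apply/andP; split; apply/eqP; ring.
Qed.

Lemma fejer_kernelE N y : fejer_kernel N (to_circle y) = (fejer_cos N y)%:C.
Proof.
rewrite /fejer_kernel /fejer_cos rmorphM /= fmorphV /= rmorph_nat rmorph_sum /=.
by congr (_ * _); apply: eq_bigr => r _; exact: dirichlet_kernelE.
Qed.

(** Induction on [l]: [sin (a + b) - sin (a - b) = 2 cos a sin b]. *)
Lemma dirichlet_cos_sin l y :
  dirichlet_cos l y * sin (pi * y) = sin (pi * l.*2.+1%:R * y).
Proof.
elim: l => [|l ih] /=; first by rewrite mul1r mulr1.
rewrite mulrDl ih.
have -> : pi * l.*2.+1%:R * y = 2 * pi * l.+1%:R * y - pi * y.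
  by rewrite -addnn -!natr1 natrD; ring.
have -> : pi * l.*2.+3%:R * y = 2 * pi * l.+1%:R * y + pi * y.
  by rewrite -addnn -!natr1 natrD; ring.
by rewrite sinB sinD; ring.
Qed.

(** Induction on [N], from [sin (a + b) * sin (b - a) = sin b ^ 2 - sin a ^ 2] with
    [a], [b] the arguments for [N] and [N + 1]. *)
Lemma fejer_cos_sin N y :
  N.+1%:R * fejer_cos N y * sin (pi * y) ^+ 2 = sin (pi * N.+1%:R * y) ^+ 2.
Proof.
rewrite /fejer_cos mulVKf ?pnatr_eq0//.
elim: N => [|N ih]; first by rewrite big_ord1 /= mul1r mulr1.
rewrite big_ord_recr mulrDl ih [sin (pi * y) ^+ 2]expr2 mulrA dirichlet_cos_sin.
have -> : pi * N.+1.*2.+1%:R * y = pi * N.+1%:R * y + pi * N.+2%:R * y.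
  by rewrite -addnn -!natr1 natrD -!natr1; ring.
set a := pi * N.+1%:R * y; set b := pi * N.+2%:R * y.
have -> : pi * y = b - a by rewrite /a /b -[N.+2%:R]natr1; ring.
rewrite sinD sinB.
have := cos2Dsin2 a; have := cos2Dsin2 b; move: (sin a) (sin b) (cos a) (cos b).
move=> sa sb ca cb /(congr1 (fun z => z - sb ^+ 2)); rewrite addrK => cbE.
move=> /(congr1 (fun z => z - sa ^+ 2)); rewrite addrK => caE.
transitivity (sa ^+ 2 + sb ^+ 2 * ca ^+ 2 - sa ^+ 2 * cb ^+ 2); first by ring.
by rewrite caE cbE; ring.
Qed.

Lemma dirichlet_cos_le l y : dirichlet_cos l y <= l.*2.+1%:R.
Proof.
elim: l => [|l ih] /=; first by [].
have := cos_le1 (2 * pi * l.+1%:R * y).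
by move: ih; rewrite -!(addn2 (l.*2.+1)) natrD => ? ?; lra.
Qed.

Lemma fejer_cos_le N y : fejer_cos N y <= N.+1%:R.
Proof.
rewrite /fejer_cos ler_pdivrMl ?ltr0n// -natrM.
have -> : (N.+1 * N.+1)%N%:R = \sum_(r < N.+1) (r.*2.+1%:R : R).
  rewrite -natr_sum; congr (_%:R).
  by elim: N => [|N ih]; rewrite ?big_ord1// big_ord_recr /= -ih; lia.
by apply: ler_sum => r _; exact: dirichlet_cos_le.
Qed.

(** At the integers, where the closed form divides by zero. *)
Lemma cos_int_dirichlet l y : sin (pi * y) = 0 -> dirichlet_cos l y = l.*2.+1%:R.
Proof.
move=> s0; elim: l => [|l ih] //=.
have -> : cos (2 * pi * l.+1%:R * y) = 1.
  have /eqP := cos2Dsin2 (pi * y); rewrite s0 expr0n addr0 => /eqP c1.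
  elim: (l.+1) => [|k ihk]; first by rewrite mulr0 mul0r cos0.
  have -> : 2 * pi * k.+1%:R * y = 2 * pi * k%:R * y + (pi * y + pi * y).
    by rewrite -natr1; ring.
  by rewrite cosD ihk cosD sinD s0 -!expr2 c1 expr0n /=; ring.
by rewrite ih -(addn2 (l.*2.+1)) natrD; lra.
Qed.

Lemma fejer_cos_ge0 N y : 0 <= fejer_cos N y.
Proof.
have [s0|s0] := eqVneq (sin (pi * y)) 0.
  rewrite /fejer_cos mulr_ge0 ?invr_ge0//; apply: sumr_ge0 => r _.
  by rewrite cos_int_dirichlet.
have s2 : 0 < sin (pi * y) ^+ 2 by rewrite exprn_even_gt0.
by rewrite -(pmulr_lge0 _ s2) -(@pmulr_rge0 _ N.+1%:R)// mulrA fejer_cos_sin sqr_ge0.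
Qed.

(** The bound passes from [2 s] to [s] because [sin (2 a) = 2 sin a cos a] is at
    most [2 sin a], and between [1 / 4] and [1 / 2] it holds because [sin (pi / 4)]
    is at least [1 / 2]. *)
Lemma sin_pi_ge s : 0 <= s <= 2^-1 -> s <= sin (pi * s).
Proof.
move=> /andP[]; rewrite le_eqVlt => /predU1P[<-|s0]; first by rewrite mulr0 sin0.
(* [k] bounds the number of doublings that bring [s] above [1 / 4]. *)
have [k] : exists k, 1 < s * 4 * 2 ^+ k.
  exists (Num.truncn (s * 4)^-1).+1.
  rewrite mulrC -ltr_pdivrMr ?mulr_gt0// mul1r; apply: (lt_trans (truncnS_gt _)).
  by rewrite -natrX ltr_nat ltn_expl.
have pi0 := pi_gt0 R.
elim: k s s0 => [|k ih] s s0 sk s2.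
  have q1 : sin (pi / 4) ^+ 2 = 2^-1 :> R.
    have := cos_pihalf R; have -> : pi / 2 = pi / 4 + pi / 4 :> R by lra.
    rewrite cosD -!expr2; have := cos2Dsin2 (pi / 4 : R); lra.
  have q2 : 2^-1 <= sin (pi / 4) :> R.
    rewrite -ler_sqr ?nnegrE; [|by lra|]; first by rewrite q1 expr2; lra.
    by apply: sin_ge0_pi; apply/andP; split; lra.
  apply: (le_trans s2); apply: (le_trans q2).
  have /orP[/eqP <-|h] : (4^-1 == s) || (4^-1 < s).
    by rewrite -le_eqVlt; move: sk; rewrite expr0; lra.
    by [].
  apply/ltW; rewrite ltr_sin ?in_itv/=; last 2 first.
  - by apply/andP; split; lra.
  - have ps : 0 <= pi * s by rewrite mulr_ge0// ltW.
    have ps2 : pi * s <= pi / 2 by rewrite ler_pM2l.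
    by apply/andP; split; lra.
  by rewrite ltr_pM2l.
have [s4|s4] := leP s 4^-1; last first.
  apply: (ih s) => //; apply: (@lt_le_trans _ _ (s * 4)); first by lra.
  by rewrite ler_peMr ?exprn_ege1//; lra.
have : s * 2 <= sin (pi * (s * 2)).
  apply: ih; [lra| |lra].
  by move: sk; rewrite exprS; congr (_ < _); ring.
have -> : pi * (s * 2) = pi * s + pi * s by ring.
rewrite sinD => h.
have c1 := cos_le1 (pi * s).
have sp : 0 <= sin (pi * s) by apply: sin_ge0_pi; apply/andP; split; nra.
nra.
Qed.

(** The closed form together with [sin (pi * y) >= y]. *)
Lemma fejer_cos_tail N y : y != 0 -> `|y| <= 2^-1 ->
  fejer_cos N y <= (N.+1%:R * y ^+ 2)^-1.
Proof.
move=> y0 y2.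
have sy : y ^+ 2 <= sin (pi * y) ^+ 2.
  have := @sin_pi_ge `|y|; rewrite normr_ge0 y2 => /(_ isT) h.
  rewrite -(real_normK (num_real y)).
  have -> : sin (pi * y) ^+ 2 = sin (pi * `|y|) ^+ 2.
    by case: (ger0P y) => _ //; rewrite mulrN sinN sqrrN.
  by rewrite ler_pXn2r ?nnegrE// (le_trans _ h)//.
have N0 : 0 < N.+1%:R :> R by rewrite ltr0n.
have yp : 0 < y ^+ 2 by rewrite exprn_even_gt0.
rewrite -div1r ler_pdivlMr; last exact: mulr_gt0.
rewrite mulrCA mulrA.
apply: le_trans (_ : N.+1%:R * fejer_cos N y * sin (pi * y) ^+ 2 <= _).
  by rewrite ler_wpM2l// mulr_ge0 ?fejer_cos_ge0// ltW.
rewrite fejer_cos_sin -[leRHS](expr1n R 2) -[leLHS]real_normK ?num_real//.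
by rewrite ler_pXn2r ?nnegrE//; exact: sin_max.
Qed.

End one_dimensional_kernel.

(** * Representatives and translations on the circle *)

Section circle_representatives.
Variable R : realType.
Notation C := (circle R).
Notation mR := (measurableTypeR R).
Notation P := (uniform_prob (@ltr01 R)).
Implicit Types (c t th : C) (y : R).

Definition frac y : R := y - (Num.floor y)%:~R.
(** The representative in [0, 1), whereas [repr] is an arbitrary one. *)
Definition crep c : R := frac (repr c).

Lemma frac_itv y : 0 <= frac y < 1.
Proof.
by have := floor_itv y; rewrite /frac intrD => /andP[? ?]; apply/andP; split; lra.
Qed.

Lemma frac_id y : 0 <= y < 1 -> frac y = y.
Proof. by move=> y01; rewrite /frac (floor_def (m := 0)) ?subr0// add0r. Qed.

Lemma fracDz y (m : int) : frac (y + m%:~R) = frac y.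
Proof. by rewrite /frac floorDrz ?intr_int// intrKfloor intrD; ring. Qed.

Lemma to_circleDz y (m : int) : to_circle (y + m%:~R) = to_circle y.
Proof. by apply/eqP; rewrite to_circleE addrC addKr intr_int. Qed.

Lemma to_circle_frac y : to_circle (frac y) = to_circle y.
Proof. by rewrite /frac -mulrNz to_circleDz. Qed.

Lemma crepE y : crep (to_circle y) = frac y.
Proof.
have /eqP : to_circle (repr (to_circle y)) = to_circle y by rewrite to_circle_repr.
rewrite to_circleE => /intrP[m mE].
by rewrite /crep -(fracDz y m) -mE addrC subrK.
Qed.

Lemma crep_itv c : 0 <= crep c < 1. Proof. exact: frac_itv. Qed.

Lemma to_circle_crep c : to_circle (crep c) = c.
Proof. by rewrite /crep to_circle_frac to_circle_repr. Qed.

Lemma to_circleD y z : to_circle (y + z) = to_circle y + to_circle z :> C.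
Proof. by rewrite -circle_addE. Qed.

Lemma to_circleN y : to_circle (- y) = - to_circle y :> C.
Proof. by rewrite -circle_oppE. Qed.

Lemma to_circleB y z : to_circle (y - z) = to_circle y - to_circle z :> C.
Proof. by rewrite to_circleD to_circleN. Qed.

Lemma measurable_frac : measurable_fun setT (frac : mR -> mR).
Proof.
apply: measurable_funB => //; apply: nondecreasing_measurable => // x y xy.
by rewrite ler_int le_floor.
Qed.

Lemma measurable_fun_circle d (T : measurableType d) (h : C -> T) :
  measurable_fun setT (h \o @to_circle R) -> measurable_fun setT h.
Proof.
by move=> mh _ A mA; rewrite setTI; have := mh measurableT A mA; rewrite setTI.
Qed.

Lemma measurable_crep : measurable_fun setT (crep : C -> mR).
Proof.
apply: measurable_fun_circle; apply: (eq_measurable_fun (frac : mR -> mR)).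
  by move=> y _ /=; rewrite crepE.
exact: measurable_frac.
Qed.

Lemma measurable_circleD th : measurable_fun setT (fun c : C => c + th).
Proof.
apply: measurable_fun_circle.
apply: (eq_measurable_fun (@to_circle R \o (fun y : mR => y + crep th))).
  by move=> y _ /=; rewrite to_circleD to_circle_crep.
apply: measurableT_comp; first exact: measurable_to_circle.
exact: measurable_funD.
Qed.

Lemma measurable_circleBl th : measurable_fun setT (fun c : C => th - c).
Proof.
apply: measurable_fun_circle.
apply: (eq_measurable_fun (@to_circle R \o (fun y : mR => crep th - y))).
  by move=> y _ /=; rewrite to_circleB to_circle_crep.
apply: measurableT_comp; first exact: measurable_to_circle.
exact: measurable_funB.
Qed.

(** The uniform measure lives on the closed interval; its right end point, a second
    representative of [0], is negligible. *)
Lemma uniform_prob01 (B : set mR) : measurable B -> P B = P (B `&` `[0, 1[).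
Proof.
move=> mB; have mI : measurable (B `&` `[0, 1[ : set mR) by exact: measurableI.
rewrite !uniform_probE//; apply/eqP; rewrite eq_le; apply/andP; split; last first.
  by apply: le_measure; rewrite ?inE; [exact: measurableI|exact: measurableI|
    move=> y [[? _] ?]; split].
apply: (@le_trans _ _ (lebesgue_measure ((B `&` `[0, 1[ `&` `[0, 1]) `|` [set 1 : R]))).
  apply: le_measure; rewrite ?inE; first exact: measurableI.
    by apply: measurableU => //; exact: measurableI.
  move=> y [By]; rewrite /= !in_itv /= => /andP[y0]; rewrite le_eqVlt => /predU1P[->|y1].
    by right.
  by left; rewrite y0 y1 orbT.
apply: (le_trans (measureU2 _ _ _)) => //; first exact: measurableI.
by rewrite [X in (_ + X)%E]lebesgue_measure_set1 adde0.
Qed.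

Lemma clip_id (x : R) : 0 <= x <= 1 -> clip x = x.
Proof. by move=> /andP[x0 x1]; rewrite /clip x1; case: leP => // ?; lra. Qed.

Lemma uniform_frac_shift (a x : R) : 0 <= a < 1 ->
  P ((fun y => frac (y + a)) @^-1` `]-oo, x[) = (clip x)%:E.
Proof.
move=> /andP[a0 a1].
have ms (u : R) : measurable_fun setT ((fun y : mR => frac (y + u)) : mR -> mR).
  by apply: (measurableT_comp measurable_frac); exact: measurable_funD.
have m1 : measurable ((fun y => frac (y + a)) @^-1` `]-oo, x[ : set mR).
  by rewrite -[X in measurable X]setTI; exact: ms.
have fr y : 0 <= y < 1 -> frac (y + a) = if y < 1 - a then y + a else y + a - 1.
  move=> /andP[y0 y1]; case: ltP => ya.
    by rewrite frac_id//; apply/andP; split; lra.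
  rewrite -(fracDz _ (-1)) frac_id//; last by apply/andP; split; lra.
rewrite uniform_prob01//.
have [x0|x0] := leP x 0.
  rewrite /clip x0 (_ : _ `&` _ = set0) ?measure0//.
  apply/seteqP; split => // y [] /=; rewrite in_itv /=.
  by have /andP[? ?] := frac_itv (y + a); lra.
have [x1|x1] := ltP 1 x.
  rewrite clip1// (_ : _ `&` _ = `[0, 1[%classic); last first.
    apply/seteqP; split => y /=; rewrite !in_itv /=; first by case.
    by have /andP[? ?] := frac_itv (y + a) => ?; split => //; lra.
  rewrite uniform_prob_co//; congr (_%:E).
  by rewrite /clip lexx ler10 lexx; lra.
have [xa|xa] := leP x a.
  rewrite (_ : _ `&` _ = `[1 - a, 1 - a + x[%classic); last first.
    apply/seteqP; split => y /=; rewrite !in_itv /=.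
      move=> [+ /[dup] y01 /andP[y0 y1]]; rewrite fr//.
      by case: (ltP y (1 - a)) => ? ?; apply/andP; split; lra.
    move=> /andP[y0 y1]; have y01 : 0 <= y < 1 by apply/andP; split; lra.
    by rewrite y01 fr//; split => //; case: (ltP y (1 - a)) => ?; lra.
  rewrite uniform_prob_co; last by lra.
  by rewrite !clip_id; [congr (_%:E); lra|apply/andP; split; lra..].
rewrite (_ : _ `&` _ = `[0, x - a[%classic `|` `[1 - a, 1[%classic); last first.
  apply/seteqP; split => y /=; rewrite !in_itv /=.
    move=> [+ /[dup] y01 /andP[y0 y1]]; rewrite fr//; case: (ltP y (1 - a)) => ? ?.
      by left; apply/andP; split; lra.
    by right; apply/andP; split; lra.
  move=> [|] /andP[y0 y1]; have y01 : 0 <= y < 1 by [apply/andP; split; lra].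
    by rewrite y01 fr//; split => //; case: (ltP y (1 - a)) => ?; lra.
  by rewrite y01 fr//; split => //; case: (ltP y (1 - a)) => ?; lra.
rewrite measureU//; last first.
  by apply/seteqP; split => // y [] /=; rewrite !in_itv /= => /andP[? ?] /andP[? ?]; lra.
rewrite [X in (X + _)%E]uniform_prob_co; last by lra.
rewrite [X in (_ + X)%E]uniform_prob_co; last by lra.
by rewrite -EFinD !clip_id; [congr (_%:E); lra|apply/andP; split; lra..].
Qed.

(** It suffices to compare the laws of [frac (y + a)] and of [y] on rays. *)
Lemma circle_measureD th (A : set C) : measurable A ->
  circle_measure R ((fun c => c + th) @^-1` A) = circle_measure R A.
Proof.
move=> mA; set a := crep th.
have ms : measurable_fun setT ((fun y : mR => frac (y + a)) : mR -> mR).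
  by apply: (measurableT_comp measurable_frac); exact: measurable_funD.
rewrite /circle_measure /= /pushforward.
have -> : @to_circle R @^-1` ((fun c => c + th) @^-1` A) =
    (fun y => frac (y + a)) @^-1` (@to_circle R @^-1` A).
  apply/funext => y /=.
  by rewrite to_circle_frac to_circleD to_circle_crep.
apply: (@eq_prob_itv R (image_measure P ms) P) => //.
  by rewrite /= /pushforward preimage_setT probability_setT ltry.
move=> x; rewrite /= /pushforward uniform_frac_shift ?crep_itv//.
by rewrite uniform_prob_lt.
Qed.

Lemma integral_circleD th (h : C -> R) : measurable_fun setT h ->
  (circle_measure R).-integrable setT (EFin \o h) ->
  \int[circle_measure R]_c h (c + th) = \int[circle_measure R]_c h c.
Proof.
move=> mh ih.
pose tr (c : C) := c + th.
have mth : measurable_fun setT tr := measurable_circleD th.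
have hE : (circle_measure R).-integrable setT (EFin \o (h \o tr)).
  apply/integrableP; split.
    by apply/measurable_EFinP; exact: (measurableT_comp mh mth).
  have /integrableP[_] := ih.
  rewrite [X in (X < _)%E -> _](_ : _ = \int[pushforward (circle_measure R) tr]_c `|(h c)%:E|)%E.
    rewrite ge0_integral_pushforward//.
    by apply/measurableT_comp => //; exact/measurable_EFinP.
  by apply: eq_measure_integral => A mA _; exact: (esym (circle_measureD th mA)).
rewrite /Rintegral -[in LHS]/(tr _); congr fine.
rewrite [RHS](_ : _ = \int[pushforward (circle_measure R) tr]_c (h c)%:E)%E.
  by rewrite (integral_pushforward mth) ?preimage_setT//; exact/measurable_EFinP.
by apply: eq_measure_integral => A mA _; exact: (esym (circle_measureD th mA)).
Qed.

End circle_representatives.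

(** * Dyadic cells and their translates by one third *)

Section dyadic_cells.
Variable R : realType.
Notation C := (circle R).
Implicit Types (c t th : C) (y : R) (l v : nat).

(** The index of the arc of length [2 ^- l] that contains [c], for the dyadic grid
    translated by [- th]. *)
Definition cell th l c : nat := Num.truncn (2 ^+ l * crep (c + th)).

Let pow2_gt0 l : 0 < 2 ^+ l :> R. Proof. by rewrite exprn_gt0. Qed.

Lemma cell_eqE th l c v :
  (cell th l c == v) = (v%:R / 2 ^+ l <= crep (c + th) < v.+1%:R / 2 ^+ l).
Proof.
have /andP[r0 r1] := crep_itv (c + th).
rewrite truncn_eq; last by rewrite mulr_ge0// ltW.
by rewrite ler_pdivrMr// ltr_pdivlMr// mulrC.
Qed.

Lemma cell_lt th l c : (cell th l c < 2 ^ l)%N.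
Proof.
have /andP[r0 r1] := crep_itv (c + th).
rewrite truncn_lt_nat; last by rewrite mulr_ge0// ltW.
by rewrite natrX -[ltRHS]mulr1 ltr_pM2l.
Qed.

Lemma cell_half th l c : cell th l c = (cell th l.+1 c)./2.
Proof.
have /andP[r0 r1] := crep_itv (c + th).
apply/eqP; rewrite truncn_eq; last by rewrite mulr_ge0// ltW.
have /truncn_itv : 0 <= 2 ^+ l.+1 * crep (c + th) by rewrite mulr_ge0// ltW.
rewrite -/(cell th l.+1 c); set m := cell _ _ _; rewrite exprS -mulrA => /andP[h1 h2].
have h3 : (m./2).*2%:R <= m%:R :> R by rewrite ler_nat; lia.
have h4 : m.+1%:R <= (m./2.+1).*2%:R :> R by rewrite ler_nat; lia.
move: h3 h4; rewrite -!muln2 !natrM => h3 h4.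
by apply/andP; split; lra.
Qed.

Lemma cell_coarser th l l' c t : (l <= l')%N ->
  cell th l' c = cell th l' t -> cell th l c = cell th l t.
Proof.
move=> /subnK <-; elim: (l' - l)%N => // k ih h; apply: ih.
by rewrite addSn in h; rewrite cell_half h -cell_half.
Qed.

Lemma cell_theta0 th l c : cell th l c = cell 0 l (c + th).
Proof. by rewrite /cell addr0. Qed.

Lemma measurable_cell th l v : measurable [set c | cell th l c = v].
Proof.
have -> : [set c | cell th l c = v] =
    (fun c => crep (c + th)) @^-1` `[v%:R / 2 ^+ l, v.+1%:R / 2 ^+ l[.
  apply/seteqP; split => c /=; rewrite in_itv /=; first by move/eqP; rewrite cell_eqE.
  by rewrite -cell_eqE => /eqP.
rewrite -[X in measurable X]setTI.
exact: (measurableT_comp (@measurable_crep R) (measurable_circleD th)).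
Qed.

Lemma circle_measure_cell th l v : (v < 2 ^ l)%N ->
  circle_measure R [set c | cell th l c = v] = (2 ^- l)%:E.
Proof.
move=> vl; have -> : [set c | cell th l c = v] =
    (fun c => c + th) @^-1` [set c | cell 0 l c = v].
  by apply/seteqP; split => c /=; rewrite (cell_theta0 th).
rewrite circle_measureD; last exact: measurable_cell.
rewrite /circle_measure /= /pushforward uniform_prob01; last first.
  by rewrite -[X in measurable X]setTI; apply: measurable_to_circle => //; exact: measurable_cell.
have v1 : v%:R / 2 ^+ l <= 1 :> R by rewrite ler_pdivrMr// mul1r -natrX ler_nat ltnW.
have v0 : 0 <= v%:R / 2 ^+ l :> R by rewrite divr_ge0// ltW.
have w1 : v.+1%:R / 2 ^+ l <= 1 :> R by rewrite ler_pdivrMr// mul1r -natrX ler_nat.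
have vw : v.+1%:R / 2 ^+ l = v%:R / 2 ^+ l + 2 ^- l :> R by rewrite -natr1 mulrDl mul1r.
have p0 : 0 < 2 ^- l :> R by rewrite invr_gt0.
rewrite (_ : _ `&` _ = `[v%:R / 2 ^+ l, v.+1%:R / 2 ^+ l[%classic); last first.
  apply/seteqP; split => y /=; rewrite !in_itv /=.
    by move=> [/eqP + y01]; rewrite cell_eqE addr0 crepE frac_id.
  move=> yv; have y01 : 0 <= y < 1 by apply/andP; split; lra.
  by split => //; apply/eqP; rewrite cell_eqE addr0 crepE frac_id.
rewrite uniform_prob_co; last by lra.
by rewrite !clip_id; [congr (_%:E); lra|apply/andP; split; lra..].
Qed.

(** A lift of the equality of cells to real representatives: the integer part of [y]
    is determined by that of [2 ^ l * y]. *)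
Lemma cell_floor l y y' : Num.floor (2 ^+ l * y) = Num.floor (2 ^+ l * y') ->
  cell 0 l (to_circle y) = cell 0 l (to_circle y').
Proof.
move=> h; have fl (z z' : R) : Num.floor (2 ^+ l * z) = Num.floor (2 ^+ l * z') ->
    (Num.floor z <= Num.floor z') :> bool.
  move=> h'; rewrite floor_ge_int -(ler_pM2l (pow2_gt0 l)).
  have -> : 2 ^+ l * (Num.floor z)%:~R = ((2 ^ l)%:Z * Num.floor z)%:~R :> R.
    by rewrite intrM -pmulrn natrX.
  rewrite -floor_ge_int -h' floor_ge_int intrM -pmulrn natrX ler_pM2l//.
  exact: floor_le.
have fE : Num.floor y = Num.floor y' by apply/eqP; rewrite eq_le !fl.
rewrite /cell !addr0 !crepE /frac -fE.
have e (z : R) : Num.floor (2 ^+ l * (z - (Num.floor y)%:~R)) =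
    Num.floor (2 ^+ l * z) - Posz (2 ^ l) * Num.floor y.
  have -> : 2 ^+ l * (z - (Num.floor y)%:~R) =
      2 ^+ l * z + (- (Posz (2 ^ l) * Num.floor y))%:~R :> R.
    by rewrite mulrNz intrM -pmulrn natrX; ring.
  by rewrite floorDrz ?intr_int// intrKfloor.
have ge0 (z : R) : 0 <= 2 ^+ l * frac z.
  by rewrite mulr_ge0 ?(ltW (pow2_gt0 l))//; have /andP[] := frac_itv z.
have := ge0 y; have := ge0 y'; rewrite /frac -fE => h1 h2.
by rewrite !truncn_floor h1 h2 !e h.
Qed.

Definition third : C := to_circle 3^-1.

Lemma floor_between (X d : R) : Num.floor X != Num.floor (X - d) ->
  exists m : int, (0 <= X - m%:~R <= d) || (d <= X - m%:~R <= 0).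
Proof.
have /andP[x1 x2] := floor_itv X; have /andP[z1 z2] := floor_itv (X - d).
have lt_int (m n : int) : m < n -> m%:~R + 1 <= n%:~R :> R.
  by rewrite -lezD1 -(ler_int R) intrD.
rewrite neq_lt => /orP[/lt_int h|/lt_int h]; move: x2 z2; rewrite !intrD => x2 z2.
  by exists (Num.floor (X - d)); apply/orP; right; apply/andP; split; lra.
by exists (Num.floor X); apply/orP; left; apply/andP; split; lra.
Qed.

(** The grids [2 ^- l * Z] and [2 ^- l * Z - 1 / 3] are at distance at least
    [1 / (3 * 2 ^ l)] because [3] does not divide [2 ^ l], so a shorter arc
    cannot meet both. *)
Lemma one_third_trick l c y : `|y| < (3 * 2 ^+ l)^-1 ->
  cell 0 l c = cell 0 l (c - to_circle y) \/
  cell third l c = cell third l (c - to_circle y).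
Proof.
move=> ys; rewrite -(to_circle_crep c); move: (crep c) => x.
rewrite -to_circleB ![cell third _ _]cell_theta0 /third -!to_circleD.
have [/eqP h|h] := boolP (cell 0 l (to_circle x) == cell 0 l (to_circle (x - y))).
  by left.
have [/eqP h'|h'] := boolP (cell 0 l (to_circle (x + 3^-1)) == cell 0 l (to_circle (x - y + 3^-1))).
  by right.
exfalso; set p : R := 2 ^+ l; have p0 : 0 < p by exact: pow2_gt0.
have ne (z z' : R) : cell 0 l (to_circle z) != cell 0 l (to_circle z') ->
    Num.floor (p * z) != Num.floor (p * z').
  by apply: contraNN => /eqP /cell_floor ->.
have {}h := ne _ _ h; rewrite mulrBr in h; have [m hm] := floor_between h.
have {}h' := ne _ _ h'; have e' : p * (x - y + 3^-1) = p * (x + 3^-1) - p * y by ring.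
rewrite e' in h'; have [m' hm'] := floor_between h'.
have dl : p * `|y| < 3^-1.
  by move: ys; rewrite invfM ltr_pdivlMr// mulrC.
have [d1 d2] : - 3^-1 < p * y /\ p * y < 3^-1.
  by apply/andP; rewrite -ltr_norml normrM gtr0_norm.
have pE : p = (2 ^ l)%N%:R by rewrite natrX.
set k := 3%:Z * (m' - m) - (2 ^ l)%N%:Z.
have kE : k%:~R = 3 * (m'%:~R - m%:~R) - p :> R.
  by rewrite rmorphB rmorphM rmorphB /= -!pmulrn -pE.
have e1 : k < 1.
  rewrite -(ltr_int R) kE mulr1z.
  by move: hm hm' => /orP[|] /andP[? ?] /orP[|] /andP[? ?]; lra.
have e2 : -1 < k.
  rewrite -(ltr_int R) kE mulrN1z.
  by move: hm hm' => /orP[|] /andP[? ?] /orP[|] /andP[? ?]; lra.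
have k0 : k = 0 by clear -e1 e2; clearbody k; lia.
have e3 : 3%:Z * (m' - m) = (2 ^ l)%N%:Z by apply/eqP; rewrite -subr_eq0; exact/eqP.
have : (3 %| (2 ^ l)%N%:Z)%Z by rewrite -e3 dvdz_mulr.
by rewrite dvdzE /= Euclid_dvdX.
Qed.

End dyadic_cells.

(** * The Fejér kernel on the circle and its domination by cells *)

Section circle_kernels.
Variable R : realType.
Notation C := (circle R).
Notation mR := (measurableTypeR R).
Implicit Types (c t th : C) (y : R) (l n N : nat).

Definition fejer_re N c : R := fejer_cos N (crep c).

Lemma fejer_kernel_re N c : fejer_kernel N c = (fejer_re N c)%:C.
Proof. by rewrite -{1}(to_circle_crep c) fejer_kernelE. Qed.

Lemma fejer_reE N y : fejer_re N (to_circle y) = fejer_cos N y.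
Proof.
have : (fejer_re N (to_circle y))%:C = (fejer_cos N y)%:C :> R[i].
  by rewrite -fejer_kernel_re fejer_kernelE.
by move=> /(congr1 (@complex.Re R)).
Qed.

Lemma fejer_re_ge0 N c : 0 <= fejer_re N c. Proof. exact: fejer_cos_ge0. Qed.

Lemma fejer_re_le N c : fejer_re N c <= N.+1%:R. Proof. exact: fejer_cos_le. Qed.

Lemma measurable_cosM (a : R) : measurable_fun setT ((fun y => cos (a * y)) : mR -> mR).
Proof.
apply: (measurableT_comp (continuous_measurable_fun (@continuous_cos R))).
exact: measurable_funM.
Qed.

Lemma measurable_fejer_re N : measurable_fun setT (fejer_re N : C -> mR).
Proof.
have md l : measurable_fun setT (dirichlet_cos l : mR -> mR).
  elim: l => [|l ih] /=; first exact: measurable_cst.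
  by apply: measurable_funD => //; apply: measurable_funM => //; exact: measurable_cosM.
apply: measurable_fun_circle; apply: (eq_measurable_fun (fejer_cos N : mR -> mR)).
  by move=> y _ /=; rewrite fejer_reE.
apply: measurable_funM => //.
apply: (eq_measurable_fun (\sum_(r < N.+1) (dirichlet_cos r : mR -> mR))%R).
  by move=> y _ /=; rewrite fct_sumE.
apply: (big_ind (fun h : mR -> mR => measurable_fun setT h)) => //.
- exact: measurable_cst.
- by move=> f g mf mg; exact: measurable_funD.
Qed.

Lemma cos_crep l y : cos (2 * pi * l%:R * crep (to_circle y)) = cos (2 * pi * l%:R * y).
Proof.
have := circle_charE l%:Z (crep (to_circle y)).
rewrite to_circle_crep circle_charE => /(congr1 (@complex.Re R)) /=.
by rewrite -!pmulrn => ->.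
Qed.

Lemma measurable_cos_circle l c :
  measurable_fun setT ((fun t => cos (2 * pi * l%:R * crep (c - t))) : C -> mR).
Proof.
apply: (measurableT_comp (measurable_cosM (2 * pi * l%:R))).
exact: (measurableT_comp (@measurable_crep R) (measurable_circleBl c)).
Qed.

Let cos_integrable l c : (circle_measure R).-integrable setT
  (EFin \o (fun t => cos (2 * pi * l%:R * crep (c - t)))).
Proof.
apply: (@bounded_integrable _ _ _ _ _ 1); first exact: measurable_cos_circle.
by move=> t; exact: cos_max.
Qed.

(** Translating [t] by half a period of the character changes the sign. *)
Lemma integral_cos_circle l c :
  \int[circle_measure R]_t cos (2 * pi * l.+1%:R * crep (c - t)) = 0.
Proof.
set g := fun t => _.
have := integral_circleD (to_circle (2 * l.+1%:R)^-1) (measurable_cos_circle l.+1 c)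
  (cos_integrable l.+1 c).
have -> : (fun t => cos (2 * pi * l.+1%:R * crep (c - (t + to_circle (2 * l.+1%:R)^-1))))
    = (fun t => - g t).
  apply/funext => t; rewrite /g opprD addrA; move: (c - t) => u.
  have -> : u - to_circle (2 * l.+1%:R)^-1 = to_circle (crep u - (2 * l.+1%:R)^-1).
    by rewrite to_circleB to_circle_crep.
  have k0 : l.+1%:R != 0 :> R by rewrite pnatr_eq0.
  rewrite cos_crep mulrBr (_ : 2 * pi * l.+1%:R * (2 * l.+1%:R)^-1 = pi).
    by rewrite cosB cospi sinpi; ring.
  by move: k0; move: (l.+1%:R : R) => k k0; field.
have -> : (fun t => - g t) = (fun t => (-1) * g t) by apply/funext => t; rewrite mulN1r.
rewrite RintegralZl//; last exact: cos_integrable.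
by rewrite -/g => ?; lra.
Qed.

Lemma integral_fejer_re N c : \int[circle_measure R]_t fejer_re N (c - t) = 1.
Proof.
pose unit_integral (h : C -> R) := (circle_measure R).-integrable setT (EFin \o h) /\
  \int[circle_measure R]_t h t = 1.
have gd l : unit_integral (fun t => dirichlet_cos l (crep (c - t))).
  elim: l => [|l [ih1 ih2]] /=.
    split; first by apply: (@bounded_integrable _ _ _ _ _ 1) => // t; rewrite normr1.
    by rewrite Rintegral_cst// mul1r [X in fine X](@probability_setT _ _ _ (circle_measure R)).
  have i2 : (circle_measure R).-integrable setT
      (EFin \o (fun t => 2 * cos (2 * pi * l.+1%:R * crep (c - t)))).
    by apply: (integrableZl measurableT 2 (cos_integrable l.+1 c)).
  split; first by apply: (integrableD measurableT ih1 i2).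
  by rewrite RintegralD// ih2 RintegralZl// integral_cos_circle mulr0 addr0.
have gs n : (circle_measure R).-integrable setT
      (EFin \o (fun t => \sum_(r < n) dirichlet_cos r (crep (c - t)))) /\
    \int[circle_measure R]_t (\sum_(r < n) dirichlet_cos r (crep (c - t))) = n%:R.
  elim: n => [|n [ih1 ih2]].
    under [X in _.-integrable _ (EFin \o X)]eq_fun do rewrite big_ord0.
    under eq_Rintegral do rewrite big_ord0.
    split; first by apply: (@bounded_integrable _ _ _ _ _ 0) => // t; rewrite normr0.
    by rewrite Rintegral_cst// mul0r.
  under [X in _.-integrable _ (EFin \o X)]eq_fun do rewrite big_ord_recr.
  under eq_Rintegral do rewrite big_ord_recr.
  have [d1 d2] := gd n.
  split; first by apply: (integrableD measurableT ih1 d1).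
  by rewrite RintegralD// ih2 d2 natr1.
have [s1 s2] := gs N.+1.
by rewrite /fejer_re /fejer_cos RintegralZl// s2 mulVf.
Qed.

Definition cell_kernel th l c t : R := 2 ^+ l * (cell th l c == cell th l t)%:R.

Lemma cell_kernel_ge0 th l c t : 0 <= cell_kernel th l c t.
Proof. by rewrite mulr_ge0// exprn_ge0. Qed.

(** The two grids of the one-third trick. *)
Definition grid_shift (b : bool) : C := if b then third R else 0.

Lemma symmetric_representative c : exists2 y, c = to_circle y & `|y| <= 2^-1.
Proof.
have /andP[r0 r1] := crep_itv c; have [r2|r2] := leP (crep c) 2^-1.
  by exists (crep c); rewrite ?to_circle_crep// ger0_norm.
exists (crep c + (-1)%:~R); first by rewrite to_circleDz to_circle_crep.
by rewrite mulrN1z ler0_norm; lra.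
Qed.

(** If [c] and [t] are at distance about [2 ^- l], the kernel is at most of
    order [4 ^ l / N], while by the one-third trick a cell of level [l] of one of
    the two grids contains both; with [2 ^ n] about [N] its normalized indicator
    [2 ^ l], weighted by [2 ^ (l - n)], has the same order. *)
Lemma fejer_re_le_cells N n c t : (2 ^ n <= N.+1)%N -> (N.+1 <= 2 ^ n.+1)%N ->
  fejer_re N (c - t) <= \sum_(i : 'I_n.+1 * bool)
    36 * 2 ^- i.1 * cell_kernel (grid_shift i.2) (n - i.1) c t.
Proof.
move=> nN Nn.
have pow2_gt0 l : 0 < 2 ^+ l :> R by rewrite exprn_gt0.
have [y ctE y2] := symmetric_representative (c - t).
have tE : t = c - to_circle y by rewrite -ctE opprB addrC subrK.
have nNR : 2 ^+ n <= N.+1%:R :> R by rewrite -natrX ler_nat.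
have NnR : N.+1%:R <= 2 * 2 ^+ n :> R by rewrite -exprS -natrX ler_nat.
(* It suffices to find one level [l] whose term alone dominates the kernel. *)
suff [l ln [lc lN]] : exists2 l, (l <= n)%N &
    (cell 0 l c = cell 0 l t \/ cell (third R) l c = cell (third R) l t) /\
    fejer_cos N y <= 36 * 2 ^+ l * 2 ^+ l / 2 ^+ n.
  have lt_nl : (n - l < n.+1)%N by rewrite ltnS leq_subr.
  have [b bE] : exists b, cell (grid_shift b) l c = cell (grid_shift b) l t.
    by case: lc => h; [exists false|exists true].
  rewrite ctE fejer_reE (bigD1 (Ordinal lt_nl, b))//= subKn// -[leLHS]addr0.
  apply: lerD; last first.
    by apply: sumr_ge0 => i _; rewrite mulr_ge0 ?cell_kernel_ge0// mulr_ge0// invr_ge0 ltW.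
  rewrite /cell_kernel bE eqxx mulr1; apply: (le_trans lN).
  have -> : 2 ^+ n = 2 ^+ l * 2 ^+ (n - l) :> R by rewrite -exprD subnKC.
  rewrite le_eqVlt; apply/orP; left; apply/eqP; field.
  by rewrite !lt0r_neq0.
(* Closer than the finest scale, the trivial bound [N + 1] is of order [2 ^ n]. *)
have [yn|yn] := ltP `|y| (3 * 2 ^+ n)^-1.
  exists n => //; split; first by rewrite tE; exact: one_third_trick.
  rewrite mulfK ?lt0r_neq0//; apply: (le_trans (fejer_cos_le _ _)).
  by have := pow2_gt0 n; lra.
have ex : exists l, (3 * 2 ^+ l)^-1 <= `|y| by exists n.
have tail l : (3 * 2 ^+ l)^-1 <= `|y| -> fejer_cos N y <= 9 * 2 ^+ l * 2 ^+ l / 2 ^+ n.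
  move=> yl; have p3 : 0 < (3 * 2 ^+ l)^-1 :> R by rewrite invr_gt0 mulr_gt0.
  have y0 : y != 0 by rewrite -normr_gt0 (lt_le_trans p3).
  apply: (le_trans (fejer_cos_tail _ y0 y2)).
  have sq : (3 * 2 ^+ l)^-1 ^+ 2 <= y ^+ 2.
    by rewrite -(real_normK (num_real y)) ler_pXn2r ?nnegrE// ltW.
  rewrite invf_ple ?posrE; last 2 first.
  - by rewrite mulr_gt0// exprn_even_gt0.
  - by rewrite !mulr_gt0// invr_gt0.
  apply: (le_trans (_ : _ <= 2 ^+ n * (3 * 2 ^+ l)^-1 ^+ 2)).
    rewrite le_eqVlt; apply/orP; left; apply/eqP; field.
    by rewrite !lt0r_neq0.
  by apply: ler_pM => //; rewrite ?exprn_ge0// ltW.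
(* Otherwise the first scale below [|y|] is preceded by a level at which the two
   points still share a cell; at level [0] there is a single cell. *)
case: (ex_minnP ex) => -[|l] /tail h hmin.
  exists 0%N => //; split.
    by left; move: (cell_lt 0 0 c) (cell_lt 0 0 t); rewrite !ltnS !leqn0 => /eqP -> /eqP ->.
  apply: (le_trans h); rewrite !expr0 !mulr1 ler_pM2r ?invr_gt0//; lra.
exists l; first by have := hmin _ yn; lia.
split.
  rewrite tE; apply: one_third_trick; rewrite ltNge; apply/negP => /hmin.
  by rewrite ltnn.
by apply: (le_trans h); rewrite ler_pM2r ?invr_gt0// !exprS; have := pow2_gt0 l; nra.
Qed.

End circle_kernels.

(** * The maximal inequality for nested countable partitions *)

Section maximal_inequality.
Context d (T : measurableType d) (R : realType) (m : {measure set T -> \bar R}).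

Lemma le_measure_bigcup_integral (w : T -> \bar R) (lam : R) (F : (set T)^nat) :
  0 <= lam -> measurable_fun setT w -> (forall x, 0 <= w x)%E ->
  (forall k, measurable (F k)) -> trivIset setT F ->
  (forall k, lam%:E * m (F k) <= \int[m]_(x in F k) w x)%E ->
  (lam%:E * m (\bigcup_k F k) <= \int[m]_x w x)%E.
Proof.
move=> lam0 mw w0 mF tF hF; have mU := bigcupT_measurable _ mF.
rewrite -integral_cst// ge0_integral_bigcup//.
apply: (@le_trans _ _ (\int[m]_(x in \bigcup_k F k) w x)%E); last first.
  by apply: ge0_subset_integral => //; exact: measurable_funS mw.
rewrite ge0_integral_bigcup//; last exact: measurable_funS mw.
apply: lee_nneseries => k _; first by rewrite integral_ge0// => x _; rewrite lee_fin.
by rewrite integral_cst.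
Qed.

(** The points where some average exceeds [lam] split, according to the first
    index at which this happens, into whole atoms on which the average exceeds
    [lam]. *)
Lemma martingale_maximal_inequality (c : nat -> T -> nat) (w : T -> \bar R) (lam : R) :
  0 <= lam -> measurable_fun setT w -> (forall x, 0 <= w x)%E ->
  (forall i v, measurable [set x | c i x = v]) ->
  (forall i x y, c i.+1 x = c i.+1 y -> c i x = c i y) ->
  let E := [set x | exists i, (lam%:E * m [set y | c i y = c i x] <
                               \int[m]_(y in [set y | c i y = c i x]) w y)%E] in
  measurable E /\ (lam%:E * m E <= \int[m]_x w x)%E.
Proof.
move=> lam0 mw w0 mc nest E.
pose atom i x := [set y | c i y = c i x].
pose big i x := (lam%:E * m (atom i x) < \int[m]_(y in atom i x) w y)%E.
have le_nest i j x y : (i <= j)%N -> c j x = c j y -> c i x = c i y.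
  by move=> /subnK <-; elim: (j - i)%N => // k ih /nest.
have big_eq i j x y : (i <= j)%N -> c j x = c j y -> big i x -> big i y.
  move=> ij cxy; have -> : big i x = big i y => //.
  rewrite /big (_ : atom i x = atom i y)//.
  by rewrite /atom (le_nest _ _ _ _ ij cxy).
(* [F] enumerates the sets where the first bad index is [i] and [c i] equals [v]. *)
pose first i x := big i x /\ forall j, (j < i)%N -> ~ big j x.
pose F k := if pickle_inv k is Some iv
  then [set x | c iv.1 x = iv.2 /\ first iv.1 x] else set0.
have FE k : F k = set0 \/ exists i x, first i x /\ F k = atom i x.
  rewrite /F; case: (pickle_inv k) => [[i v]|]; last by left.
  have [->|/set0P[x /= [cx fx]]] := eqVneq [set x | c i x = v /\ first i x] set0.
    by left.
  right; exists i, x; split => //; apply/seteqP; split => y /=.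
    by rewrite /atom /= => -[-> _].
  rewrite /atom /= => cyx; rewrite cyx cx; split => //; case: fx => bx nb; split.
    by apply: (big_eq i i x y (leqnn i) (esym cyx)).
  by move=> j ji /(big_eq _ i _ x (ltnW ji) cyx); exact: nb.
have mF k : measurable (F k).
  by have [->//|[i [x [_ ->]]]] := FE k; exact: mc.
have EF : E = \bigcup_k F k.
  apply/seteqP; split => x.
    move=> [i bi]; have ex : exists i, big i x by exists i.
    case: (ex_minnP ex) => j bj jmin.
    exists (pickle (j, c j x)) => //; rewrite /F pickleK_inv /=; split => //; split => //.
    by move=> k kj /jmin; rewrite leqNgt kj.
  move=> [k _]; rewrite /F; case: (pickle_inv k) => [[i v] /= [_ [bx _]]|//].
  by exists i.
have tF : trivIset setT F.
  apply/trivIsetP => k k' _ _ kk'; apply/seteqP; split => // x [].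
  rewrite /F; case uk: (pickle_inv k) => [[i v]|//]; case uk': (pickle_inv k') => [[i' v']|//].
  move=> /= [cv [bx nb]] [cv' [bx' nb']]; move: kk' => /eqP; apply.
  have ii' : i = i'.
    apply/eqP; rewrite eqn_leq; apply/andP; split; rewrite leqNgt; apply/negP.
      by move=> /nb /(_ bx').
    by move=> /nb' /(_ bx).
  have := @pickle_invK (nat * nat)%type k; have := @pickle_invK (nat * nat)%type k'.
  by rewrite uk uk' /= => <- <-; rewrite -cv -cv' ii'.
rewrite EF; split; first exact: bigcupT_measurable.
apply: le_measure_bigcup_integral => // k.
have [->|[i [x [[bx _] ->]]]] := FE k; first by rewrite measure0 mule0 integral_set0.
exact: ltW.
Qed.

End maximal_inequality.

(** * Integrals of products of functions of one coordinate *)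

Section torus_products.
Variable R : realType.
Notation C := (circle R).
Notation T := (torus R).
Notation mu := (torus_measure R).
Notation circ := (circle_measure R).

Lemma torus_measure_box p (A : 'I_p -> set C) : (forall j, measurable (A j)) ->
  measurable [set x : T | forall j : 'I_p, A j (x j)] /\
  mu [set x : T | forall j : 'I_p, A j (x j)] = (\prod_(j < p) circ (A j))%E.
Proof.
move=> mA; pose A' n := if insub n is Some j then A j else setT.
have mA' n : measurable (A' n) by rewrite /A'; case: insub.
have A'E (j : 'I_p) : A' j = A j by rewrite /A' valK.
have -> : [set x : T | forall j : 'I_p, A j (x j)] = cylinder p A'.
  apply/seteqP; split => x /= xA.
    by move=> n np; rewrite -[n]/(val (Ordinal np)) A'E; exact: xA.
  by move=> j; rewrite -A'E; exact: xA.
split; first exact: measurable_cylinder.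
rewrite (torus_measureP p mA'); apply: eq_bigr => j _.
by rewrite A'E.
Qed.

(** Prefixing a coordinate, which identifies the product of the circle and the torus
    with the torus. *)
Definition torus_cons (z : C * T) : T := fun n => if n is n'.+1 then z.2 n' else z.1.

Lemma measurable_torus_cons : measurable_fun setT torus_cons.
Proof.
apply: (@measurability _ _ (C * T)%type T setT torus_cons (@coordinate_sets R)) => //.
move=> _ [_ [n _ [A mA <-]] <-]; rewrite !setTI.
have mn : measurable_fun setT (fun z => torus_cons z n).
  case: n => [|n] /=; first exact: measurable_fst.
  exact: (measurableT_comp (measurable_coordinate n) measurable_snd).
by have := mn measurableT A mA; rewrite setTI.
Qed.

HB.instance Definition _ := isMeasurableFun.Build _ _ _ _
  torus_cons measurable_torus_cons.

(** Uniqueness of the product measure, checked on cylinders. *)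
Lemma torus_cons_measure (E : set T) : measurable E ->
  mu E = (circ \x mu)%E (torus_cons @^-1` E).
Proof.
pose nu : probability T R := distribution (circ \x mu)%E torus_cons.
apply: (@Defs.product_measure_unique R mu nu); first exact: torus_measureP.
move=> [|p] A mA.
  rewrite big_ord0 (_ : cylinder 0 A = setT) ?probability_setT//.
  by apply/seteqP; split.
rewrite big_ord_recl /=.
rewrite -[LHS]/((circ \x mu)%E (torus_cons @^-1` cylinder p.+1 A)).
rewrite (_ : _ @^-1` _ = A 0%N `*` cylinder p (fun n => A n.+1)).
  rewrite product_measure1E//; last exact: measurable_cylinder.
  by congr (_ * _)%E; apply: (torus_measureP p (fun n => mA n.+1)).
apply/seteqP; split => -[c x] /=.
  by move=> h; split; [exact: (h 0%N)|move=> n np; exact: (h n.+1)].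
by move=> [h0 h] [|n] np; [exact: h0|exact: h].
Qed.

(** Tonelli's theorem, splitting off one coordinate at a time. *)
Lemma integral_torus_prod p (h : nat -> C -> R) :
  (forall j, measurable_fun setT (h j)) -> (forall j c, 0 <= h j c) ->
  (\int[mu]_t (\prod_(j < p) h j (t j))%:E = \prod_(j < p) \int[circ]_c (h j c)%:E)%E.
Proof.
have mprod q (k : nat -> C -> R) : (forall j, measurable_fun setT (k j)) ->
    measurable_fun setT (fun t : T => \prod_(j < q) k j (t j)).
  move=> mk; elim: q => [|q ih].
    rewrite (_ : (fun t : T => _) = cst 1); first exact: measurable_cst.
    by apply/funext => t; rewrite big_ord0.
  rewrite (_ : (fun t : T => _) = (fun t => (\prod_(j < q) k j (t j)) * k q (t q))); last first.
    by apply/funext => t; rewrite big_ord_recr.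
  apply: measurable_funM => //.
  exact: (measurableT_comp (mk q) (measurable_coordinate q)).
elim: p h => [|p ih] h mh h0.
  rewrite big_ord0; under eq_integral do rewrite big_ord0.
  by rewrite integral_cst// mul1e [X in X = _](@probability_setT _ _ _ mu).
rewrite big_ord_recl -(ih (fun j => h j.+1))//=.
have mF : measurable_fun setT (fun t : T => (\prod_(j < p.+1) h j (t j))%:E).
  by apply/measurable_EFinP; exact: mprod.
have F0 (t : T) : (0 <= (\prod_(j < p.+1) h j (t j))%:E)%E.
  by rewrite lee_fin prodr_ge0.
transitivity (\int[pushforward (circ \x mu)%E torus_cons]_t (\prod_(j < p.+1) h j (t j))%:E)%E.
  by apply: eq_measure_integral => E mE _; exact: torus_cons_measure.
rewrite (ge0_integral_pushforward measurable_torus_cons)//.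
rewrite preimage_setT fubini_tonelli1//; last 2 first.
- exact: (measurableT_comp mF measurable_torus_cons).
- by move=> z; exact: F0.
rewrite /fubini_F /=.
under eq_integral => c _.
  under eq_integral => t _ do rewrite big_ord_recl /= EFinM.
  rewrite ge0_integralZl//; last 3 first.
  - by apply/measurable_EFinP; exact: (mprod p (fun j => h j.+1)).
  - by move=> t _; rewrite lee_fin prodr_ge0.
  - by rewrite lee_fin.
  over.
rewrite ge0_integralZr//.
- exact/measurable_EFinP.
- by move=> c _; rewrite lee_fin.
- by apply: integral_ge0 => t _; rewrite lee_fin prodr_ge0.
Qed.

Lemma Rintegral_torus_prod p (h : nat -> C -> R) (M : R) :
  (forall j, measurable_fun setT (h j)) -> (forall j c, 0 <= h j c <= M) ->
  \int[mu]_t (\prod_(j < p) h j (t j)) = \prod_(j < p) \int[circ]_c h j c.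
Proof.
move=> mh hM; rewrite /Rintegral integral_torus_prod//; last first.
  by move=> j c; have /andP[] := hM j c.
have ih j : circ.-integrable setT (EFin \o h j).
  apply: (@bounded_integrable _ _ _ _ _ M) => // c; have /andP[h0 h1] := hM j c.
  by rewrite ger0_norm.
rewrite (eq_bigr (fun j : 'I_p => (fine (\int[circ]_c (h j c)%:E))%:E)).
  by rewrite prodEFin.
by move=> j _; rewrite fineK//; exact: (integrable_fin_num measurableT (ih j)).
Qed.

End torus_products.

(** * Means over finitely many coordinates *)

Section means.
Variable R : realType.
Notation C := (circle R).
Notation T := (torus R).
Notation mu := (torus_measure R).
Notation L1 u := (mu.-integrable setT (EFin \o u)).
Implicit Types (u v w : T -> R) (x t : T).

Definition bounded_kernel (k : C -> C -> R) :=
  (forall c, measurable_fun setT (k c)) /\ exists M, forall c c', 0 <= k c c' <= M.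

Definition kprod p (k : 'I_p -> C -> C -> R) x t : R := \prod_(j < p) k j (x j) (t j).

(** The mean at [x] over the first [p] coordinates; [u] is integrated over the others. *)
Definition pmean p (k : 'I_p -> C -> C -> R) u x : R := \int[mu]_t (kprod k x t * u t).

Lemma measurable_prod_coord (I : Type) (s : seq I) (n : I -> nat) (h : I -> C -> R) :
  (forall i, measurable_fun setT (h i)) ->
  measurable_fun setT (fun t : T => \prod_(i <- s) h i (t (n i))).
Proof.
move=> mh; elim: s => [|i s ih].
  rewrite (_ : (fun t : T => _) = cst 1); first exact: measurable_cst.
  by apply/funext => t; rewrite big_nil.
rewrite (_ : (fun t : T => _) = (fun t => h i (t (n i)) * \prod_(i <- s) h i (t (n i)))).
  apply: measurable_funM => //.
  exact: (measurableT_comp (mh i) (measurable_coordinate (n i))).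
by apply/funext => t; rewrite big_cons.
Qed.

Lemma measurable_kprod p (k : 'I_p -> C -> C -> R) x :
  (forall j, bounded_kernel (k j)) -> measurable_fun setT (kprod k x : T -> R).
Proof.
move=> hk; apply: (@measurable_prod_coord _ _ (@nat_of_ord p) (fun j => k j (x j))).
by move=> j; have [mk _] := hk j.
Qed.

Lemma kprod_bounded p (k : 'I_p -> C -> C -> R) : (forall j, bounded_kernel (k j)) ->
  exists M, forall x t, 0 <= kprod k x t <= M.
Proof.
move=> hk; have /choice[M hM] : forall j, exists M, forall c c', 0 <= k j c c' <= M.
  by move=> j; have [_] := hk j.
exists (\prod_j M j) => x t; rewrite /kprod prodr_ge0; last first.
  by move=> j _; have /andP[] := hM j (x j) (t j).
by apply: ler_prod => j _; exact: hM.
Qed.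

Lemma kprod_ge0 p (k : 'I_p -> C -> C -> R) x t : (forall j, bounded_kernel (k j)) ->
  0 <= kprod k x t.
Proof. by move=> /kprod_bounded[M hM]; have /andP[] := hM x t. Qed.

Lemma kprod_integrable p (k : 'I_p -> C -> C -> R) u x :
  (forall j, bounded_kernel (k j)) -> L1 u -> L1 (fun t => kprod k x t * u t).
Proof.
move=> hk iu; have [M hM] := kprod_bounded hk.
apply: (le_integrable measurableT _ _ (integrableZl measurableT M iu)).
  apply/measurable_EFinP; apply: measurable_funM; first exact: measurable_kprod.
  by apply/measurable_EFinP; exact: (measurable_int mu).
move=> t _ /=; rewrite lee_fin !normrM ler_wpM2r//.
by have /andP[k0 k1] := hM x t; rewrite !ger0_norm// (le_trans k0).
Qed.

Lemma pmeanD p (k : 'I_p -> C -> C -> R) u v x : (forall j, bounded_kernel (k j)) ->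
  L1 u -> L1 v -> pmean k (fun t => u t + v t) x = pmean k u x + pmean k v x.
Proof.
move=> hk iu iv; rewrite /pmean -RintegralD//; try exact: kprod_integrable.
by apply: eq_Rintegral => t _; rewrite mulrDr.
Qed.

Lemma pmeanZ p (k : 'I_p -> C -> C -> R) (a : R) u x : (forall j, bounded_kernel (k j)) ->
  L1 u -> pmean k (fun t => a * u t) x = a * pmean k u x.
Proof.
move=> hk iu; rewrite /pmean -RintegralZl//; last exact: kprod_integrable.
by apply: eq_Rintegral => t _; rewrite mulrCA.
Qed.

Lemma pmeanB p (k : 'I_p -> C -> C -> R) u v x : (forall j, bounded_kernel (k j)) ->
  L1 u -> L1 v -> pmean k (fun t => u t - v t) x = pmean k u x - pmean k v x.
Proof.
move=> hk iu iv; rewrite /pmean -RintegralB//; try exact: kprod_integrable.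
by apply: eq_Rintegral => t _; rewrite mulrBr.
Qed.

Lemma normr_pmean p (k : 'I_p -> C -> C -> R) u x : (forall j, bounded_kernel (k j)) ->
  L1 u -> `|pmean k u x| <= pmean k (fun t => `|u t|) x.
Proof.
move=> hk iu; apply: (le_trans (le_normr_Rintegral measurableT _)).
  exact: kprod_integrable.
rewrite le_eqVlt; apply/orP; left; apply/eqP; apply: eq_Rintegral => t _.
by rewrite normrM ger0_norm// kprod_ge0.
Qed.

Lemma bounded_cell_kernel (th : C) l : bounded_kernel (cell_kernel th l).
Proof.
split=> [c|].
  rewrite /cell_kernel; apply: measurable_funM => //.
  rewrite (_ : (fun t : C => _) = \1_[set t : C | cell th l t = cell th l c] :> (C -> R)).
    by apply: measurable_indic; exact: measurable_cell.
  apply/funext => t; rewrite indicE; congr (_%:R); congr (nat_of_bool _).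
  by apply/eqP/idP; rewrite inE /= => ->.
exists (2 ^+ l) => c t; rewrite cell_kernel_ge0 /cell_kernel ler_piMr ?exprn_ge0//.
by case: eqP.
Qed.

Lemma bounded_fejer N : bounded_kernel (fun c t : C => fejer_re N (c - t)).
Proof.
split=> [c|]; first exact: (measurableT_comp (@measurable_fejer_re R N) (measurable_circleBl c)).
by exists N.+1%:R => c t; rewrite fejer_re_ge0 fejer_re_le.
Qed.

(** The cell of [x] in the first [p] coordinates, coded by a natural number so that
    the partition into cells is visibly countable. *)
Definition tcell p (th : 'I_p -> C) (l : 'I_p -> nat) x : nat :=
  pickle [ffun j : 'I_p => cell (th j) (l j) (x j)].

Lemma tcellP p (th : 'I_p -> C) (l : 'I_p -> nat) x y :
  tcell th l x = tcell th l y <-> forall j, cell (th j) (l j) (x j) = cell (th j) (l j) (y j).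
Proof.
split; first by move=> /(pcan_inj pickleK) /ffunP h j; have := h j; rewrite !ffunE.
by move=> h; congr pickle; apply/ffunP => j; rewrite !ffunE.
Qed.

Lemma tcell_atom p (th : 'I_p -> C) (l : 'I_p -> nat) x :
  measurable [set y : T | tcell th l y = tcell th l x] /\
  mu [set y | tcell th l y = tcell th l x] = (\prod_(j < p) 2 ^- l j)%:E.
Proof.
have -> : [set y : T | tcell th l y = tcell th l x] =
    [set y : T | forall j : 'I_p, [set c | cell (th j) (l j) c = cell (th j) (l j) (x j)] (y j)].
  by apply/seteqP; split => y /tcellP.
have [|h1 h2] := @torus_measure_box R p
  (fun j => [set c | cell (th j) (l j) c = cell (th j) (l j) (x j)]).
  by move=> j; exact: measurable_cell.
split=> //; rewrite h2 -prodEFin; apply: eq_bigr => j _.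
by rewrite circle_measure_cell// cell_lt.
Qed.

Lemma measurable_tcell p (th : 'I_p -> C) (l : 'I_p -> nat) (n : nat) :
  measurable [set y : T | tcell th l y = n].
Proof.
have [->//|/set0P[x /= <-]] := eqVneq [set y : T | tcell th l y = n] set0.
by have [] := tcell_atom th l x.
Qed.

Lemma kprod_cell p (th : 'I_p -> C) (l : 'I_p -> nat) x t :
  kprod (fun j => cell_kernel (th j) (l j)) x t =
  (\prod_(j < p) 2 ^+ l j) * \1_[set y : T | tcell th l y = tcell th l x] t.
Proof.
rewrite /kprod /cell_kernel big_split /=; congr (_ * _); rewrite indicE.
set A := [set y | _]; have [/set_mem /tcellP h|/negP h] := boolP (t \in A).
  by rewrite big1// => j _; rewrite h eqxx.
have [j /eqP hj] : exists j, cell (th j) (l j) (x j) <> cell (th j) (l j) (t j).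
  apply: contrapT => hn; apply: h; rewrite in_setE; apply/tcellP => j.
  by apply: contrapT => hj; apply: hn; exists j => h; exact: hj (esym h).
by rewrite (bigD1 j)//= (negbTE hj) mul0r.
Qed.

(** A mean against cell kernels is the average over the atom of [tcell] that contains
    [x], so this is the maximal inequality for nested partitions. The number [p i] of
    coordinates may vary with [i]: both the passage to finer levels and the addition
    of coordinates are covered. *)
Lemma cell_mean_maximal (p : nat -> nat) (th : forall i, 'I_(p i) -> C)
    (l : forall i, 'I_(p i) -> nat) w (lam : R) :
  (forall i x y, tcell (th i.+1) (l i.+1) x = tcell (th i.+1) (l i.+1) y ->
     tcell (th i) (l i) x = tcell (th i) (l i) y) ->
  L1 w -> 0 < lam ->
  exists B, [/\ measurable B, (lam%:E * mu B <= \int[mu]_t `|w t|%:E)%E &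
    forall x, ~ B x -> forall i,
      pmean (fun j => cell_kernel (th i j) (l i j)) (fun t => `|w t|) x <= lam].
Proof.
move=> nest iw lam0.
have mw : measurable_fun setT (fun t => `|w t|%:E).
  by apply/measurable_EFinP/measurableT_comp => //; apply/measurable_EFinP; exact: (measurable_int mu).
have w0 t : (0 <= `|w t|%:E)%E by rewrite lee_fin.
have [mB lB] := martingale_maximal_inequality mu (c := fun i => tcell (th i) (l i)) (ltW lam0)
  mw w0 (fun i => measurable_tcell (th i) (l i)) nest.
set B := [set x | _] in mB lB; exists B; split => // x nBx i.
rewrite leNgt; apply/negP => h; apply: nBx; exists i.
have [mA muA] := tcell_atom (th i) (l i) x.
have P0 : 0 < \prod_(j < p i) 2 ^+ l i j :> R by apply: prodr_gt0 => j _; rewrite exprn_gt0.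
rewrite [X in (_ * X)%E]muA.
have -> : \prod_(j < p i) 2 ^- l i j = (\prod_(j < p i) 2 ^+ l i j)^-1 :> R by rewrite prodfV.
move: h P0; rewrite /pmean.
under eq_Rintegral => t _ do rewrite kprod_cell -mulrA.
move: (\prod_(j < p i) _) => P; set A := [set y | _] => + P0.
have iA : L1 (fun t => \1_A t * `|w t|).
  apply: (le_integrable measurableT _ _ iw).
    apply/measurable_EFinP/measurable_funM; first exact: measurable_indic.
    exact/measurable_EFinP.
  move=> t _ /=; rewrite lee_fin normrM normr_id ler_piMl// indicE.
  by case: (t \in A); rewrite ?normr1 ?normr0.
rewrite RintegralZl// mulrC -ltr_pdivrMr// => h.
have -> : (\int[mu]_(t in A) `|w t|%:E = (\int[mu]_t (\1_A t * `|w t|))%:E)%E.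
  rewrite /Rintegral fineK; last exact: (integrable_fin_num measurableT iA).
  rewrite [LHS]integral_mkcond; apply: eq_integral => t _; rewrite patchE indicE.
  by case: ifP => _; rewrite ?mul1r ?mul0r.
by rewrite -EFinM lte_fin.
Qed.

End means.

(** * The weak-type bound for Fejér means over cubes *)

Section fejer_maximal.
Variable R : realType.
Notation C := (circle R).
Notation T := (torus R).
Notation mu := (torus_measure R).
Notation L1 u := (mu.-integrable setT (EFin \o u)).
Implicit Types (u w : T -> R) (x t : T).

Lemma sum_pow_le (q : R) n : 0 <= q -> (1 - q) * \sum_(a < n) q ^+ a <= 1.
Proof.
move=> q0; have -> : (1 - q) * \sum_(a < n) q ^+ a = 1 - q ^+ n.
  by rewrite -[1 in RHS](expr1n _ n) subrXX; congr (_ * _); apply: eq_bigr => i _; rewrite expr1n mul1r.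
by rewrite gerBl exprn_ge0.
Qed.

(** The sum of products factors; the doubling comes from the Boolean component. *)
Lemma sum_ffun_prod_le p n (F : nat -> R) (K : R) : (forall a, 0 <= F a) ->
  (\sum_(a < n) F a) *+ 2 <= K ->
  \sum_(f : {ffun 'I_p -> 'I_n * bool}) \prod_j F (f j).1 <= K ^+ p.
Proof.
move=> F0 FK; rewrite -(bigA_distr_bigA (fun _ (i : 'I_n * bool) => F i.1)).
rewrite prodr_const card_ord /=.
have SE : \sum_(i : 'I_n * bool) F i.1 = (\sum_(a < n) F a) *+ 2.
  rewrite -(pair_bigA _ (fun (a : 'I_n) (b : bool) => F a)) /=.
  by under eq_bigr do rewrite big_bool /= -mulr2n; rewrite sumrMnl.
have S0 : 0 <= \sum_(i : 'I_n * bool) F i.1 by apply: sumr_ge0.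
rewrite SE in S0; rewrite [X in X ^+ p <= _]SE.
by apply: lerXn2r; rewrite ?nnegrE// (le_trans S0).
Qed.

Notation fk N := (fun c c' : C => fejer_re N (c - c')).

(** The factor by which the threshold [lam'] is raised at the offsets [(f j).1]. *)
Let wt p (f : {ffun 'I_p -> nat * bool}) : R := \prod_j (4 / 3) ^+ (f j).1.

Let widen p n (f : {ffun 'I_p -> 'I_n * bool}) : {ffun 'I_p -> nat * bool} :=
  [ffun j => (nat_of_ord (f j).1, (f j).2)].

(** Multiplying out the domination of the kernel over the [p] coordinates bounds the
    Fejér mean of order about [2 ^ n] by averages over boxes of levels [n - a_j] in
    the [j]-th coordinate, on one of the two grids, with weights [36 * 2 ^- a_j]. For
    fixed offsets [a] and grids, the boxes are nested as [n] grows, so their maximal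
    function obeys the weak-type bound with constant one. Outside the sets where it
    exceeds [lam'] times the product of the [(4 / 3) ^ a_j], the weighted sum is
    controlled by the convergent series of the [36 * (2 / 3) ^ a_j], and the measures
    of these sets add up to a convergent series in the [(3 / 4) ^ a_j]. *)
Lemma fejer_maximal p w (lam : R) : L1 w -> 0 < lam ->
  exists B, [/\ measurable B, (lam%:E * mu B <= ((6 ^+ 3 * 8) ^+ p)%:E * \int[mu]_t `|w t|%:E)%E &
    forall x, ~ B x -> forall N, pmean (fun _ : 'I_p => fk N) (fun t => `|w t|) x <= lam].
Proof.
move=> iw lam0.
(* [K] is twice the sum of the series [36 * (2 / 3) ^ a], and [8] is twice that of
   [(3 / 4) ^ a]. *)
pose K : R := 6 ^+ 3; have KE : 36 * 2 * 3 = K by rewrite /K; ring.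
have K0 : 0 < K by rewrite exprn_gt0.
rewrite -/K; clearbody K.
pose lam' := lam / K ^+ p.
have lam'0 : 0 < lam' by rewrite divr_gt0// exprn_gt0.
have wt0 (f : {ffun 'I_p -> nat * bool}) : 0 < wt f by apply: prodr_gt0 => j _; rewrite exprn_gt0.
have /choice[B hB] : forall f : {ffun 'I_p -> nat * bool}, exists B, [/\ measurable B,
    ((lam' * wt f)%:E * mu B <= \int[mu]_t `|w t|%:E)%E &
    forall x, ~ B x -> forall n,
      pmean (fun j : 'I_p => cell_kernel (grid_shift R (f j).2) (n - (f j).1))
        (fun t => `|w t|) x <= lam' * wt f].
  move=> f; apply: (@cell_mean_maximal R (fun _ => p) (fun _ j => grid_shift R (f j).2)
    (fun n j => (n - (f j).1)%N)) => //; last by rewrite mulr_gt0.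
  move=> n x y /tcellP h; apply/tcellP => j; apply: cell_coarser (h j).
  by rewrite leq_sub2r.
pose W := \int[mu]_t `|w t|.
have WE : (\int[mu]_t `|w t|%:E = W%:E)%E.
  by rewrite fineK//; exact: (integrable_fin_num measurableT (L1_norm iw)).
have W0 : 0 <= W by apply: Rintegral_ge0.
have mB f : measurable (B f) by have [] := hB f.
have muB f : (mu (B f) <= (W / lam' / wt f)%:E)%E.
  have c0 : 0 < lam' * wt f by rewrite mulr_gt0.
  have [_ + _] := hB f; rewrite WE -(lee_pdivlMl _ _ c0) => /le_trans; apply.
  by rewrite -EFinM lee_fin le_eqVlt; apply/orP; left; apply/eqP; rewrite invfM; ring.
(* Offsets below [n] form a finite set; the exceptional set is the increasing union. *)
pose Bn n := \big[setU/set0]_(f : {ffun 'I_p -> 'I_n * bool}) B (widen f).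
have Bn_le n := measure_bigsetU_le mu (index_enum _)
  (fun f : {ffun 'I_p -> 'I_n * bool} => mB (widen f)).
have mBn n : measurable (Bn n) by have [] := Bn_le n.
have muBn n : (mu (Bn n) <= (8 ^+ p * (W / lam'))%:E)%E.
  have [_ /le_trans] := Bn_le n; apply.
  apply: (@le_trans _ _
    (\sum_(f : {ffun 'I_p -> 'I_n * bool}) (W / lam' / wt (widen f))%:E)%E).
    by apply: lee_sum => f _; exact: muB.
  rewrite sumEFin lee_fin -mulr_sumr mulrC; apply: ler_wpM2r; first by rewrite divr_ge0// ltW.
  rewrite (eq_bigr (fun f : {ffun 'I_p -> 'I_n * bool} => \prod_j (3 / 4) ^+ (f j).1)); last first.
    move=> f _; rewrite /wt -prodfV; apply: eq_bigr => j _.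
    by rewrite ffunE /= -exprVn invf_div.
  apply: (@sum_ffun_prod_le p n (fun a => (3 / 4) ^+ a)); first by move=> a; rewrite exprn_ge0.
  rewrite mulr2n; have : 0 <= 3 / 4 :> R by [].
  by move=> /(sum_pow_le n) ?; lra.
have BnE n x : Bn n x <-> exists f : {ffun 'I_p -> 'I_n * bool}, B (widen f) x.
  rewrite /Bn -bigcup_seq; split; first by move=> [f _ h]; exists f.
  by move=> [f h]; exists f => //=; rewrite mem_index_enum.
have Bnd : nondecreasing_seq Bn.
  apply/nondecreasing_seqP => n; apply/subsetPset => x /BnE [f h]; apply/BnE.
  exists [ffun j => (widen_ord (leqnSn n) (f j).1, (f j).2)].
  rewrite (_ : widen _ = widen f)//; apply/ffunP => j.
  by rewrite !ffunE.
have mU : measurable (\bigcup_n Bn n) by apply: bigcupT_measurable.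
exists (\bigcup_n Bn n); split => //.
  have : (mu (\bigcup_n Bn n) <= (8 ^+ p * (W / lam'))%:E)%E.
    exact: measure_bigcup_le.
  rewrite WE -EFinM => h; apply: (le_trans (lee_wpmul2l _ h)).
    by rewrite lee_fin ltW.
  rewrite -EFinM lee_fin le_eqVlt; apply/orP; left; apply/eqP.
  rewrite exprMn /lam'; field.
  by rewrite !lt0r_neq0// exprn_gt0.
move=> x nBx N.
have [n nN Nn] : exists2 n, (2 ^ n <= N.+1)%N & (N.+1 <= 2 ^ n.+1)%N.
  by exists (trunc_log 2 N.+1); [exact: trunc_logP|exact/ltnW/trunc_log_ltn].
pose F (f : {ffun 'I_p -> 'I_n.+1 * bool}) :=
  fun j : 'I_p => cell_kernel (grid_shift R (f j).2) (n - (f j).1).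
pose cf (f : {ffun 'I_p -> 'I_n.+1 * bool}) : R := \prod_j (36 * 2 ^- (f j).1).
have bF f j : bounded_kernel (F f j) by exact: bounded_cell_kernel.
have cf0 f : 0 <= cf f by apply: prodr_ge0 => j _; rewrite mulr_ge0// invr_ge0 exprn_ge0.
(* The domination of the kernel in each coordinate, multiplied out. *)
have dom t : kprod (fun _ : 'I_p => fk N) x t <= \sum_f cf f * kprod (F f) x t.
  rewrite /kprod /cf; under [leRHS]eq_bigr do rewrite -big_split /=.
  rewrite /F -(bigA_distr_bigA (fun (j : 'I_p) (i : 'I_n.+1 * bool) =>
    36 * 2 ^- i.1 * cell_kernel (grid_shift R i.2) (n - i.1) (x j) (t j))).
  by apply: ler_prod => j _; rewrite fejer_re_ge0 fejer_re_le_cells.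
have iF f : L1 (fun t => cf f * (kprod (F f) x t * `|w t|)).
  by apply: (integrableZl measurableT (cf f) (kprod_integrable x (bF f) (L1_norm iw))).
have [iS SE] := Rintegral_bigsum (index_enum _) iF.
apply: (@le_trans _ _ (\sum_f cf f * pmean (F f) (fun t => `|w t|) x)).
  rewrite (eq_bigr (fun f => \int[mu]_t (cf f * (kprod (F f) x t * `|w t|)))); last first.
    by move=> f _; rewrite RintegralZl//; exact: (kprod_integrable x (bF f) (L1_norm iw)).
  rewrite -SE; apply: le_Rintegral => //.
    by apply: kprod_integrable; [move=> _; exact: bounded_fejer|exact: L1_norm].
  move=> t _; under eq_bigr do rewrite mulrA.
  by rewrite -mulr_suml ler_wpM2r.
apply: (@le_trans _ _ (\sum_f cf f * (lam' * wt (widen f)))).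
  apply: ler_sum => f _; rewrite ler_wpM2l//.
  have [_ _ h] := hB (widen f).
  have -> : F f = (fun j : 'I_p => cell_kernel (grid_shift R (widen f j).2) (n - (widen f j).1)).
    by apply/funext => j; rewrite /F ffunE.
  by apply: h => Bx; apply: nBx; exists n.+1 => //; apply/BnE; exists f.
under eq_bigr do rewrite mulrCA; rewrite -mulr_sumr.
rewrite /lam' mulrAC ler_pdivrMr ?exprn_gt0//; apply: ler_wpM2l; first exact: ltW.
rewrite (eq_bigr (fun f : {ffun 'I_p -> 'I_n.+1 * bool} =>
  \prod_j (36 * (2 / 3) ^+ (f j).1))); last first.
  move=> f _; rewrite /wt /cf -big_split /=; apply: eq_bigr => j _.
  rewrite ffunE /= -mulrA; congr (_ * _).
  by rewrite -exprVn -exprMn; congr (_ ^+ _); lra.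
apply: (@sum_ffun_prod_le p n.+1 (fun a => 36 * (2 / 3) ^+ a)).
  by move=> a; rewrite mulr_ge0// exprn_ge0.
rewrite -mulr_sumr mulr2n; have : 0 <= 2 / 3 :> R by [].
by move=> /(sum_pow_le n.+1) ?; lra.
Qed.

End fejer_maximal.

(** * Dyadic sets and approximation in one coordinate *)

Section dyadic_sets.
Variable R : realType.
Notation C := (circle R).
Notation T := (torus R).
Notation circ := (circle_measure R).
Implicit Types (c : C) (S U : set C) (x : T).

(** Unions of cells of one level. *)
Definition dyadic S := exists l, forall c c', cell 0 l c = cell 0 l c' -> S c -> S c'.

Lemma measurable_dyadic S : dyadic S -> measurable S.
Proof.
move=> [l Sl]; rewrite (_ : S = \bigcup_(v in [set v | exists2 c, S c & cell 0 l c = v])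
    [set c | cell 0 l c = v]); last first.
  apply/seteqP; split => c; first by move=> Sc; exists (cell 0 l c) => //=; exists c.
  by move=> [v [c' Sc' <-]] /= e; apply: Sl Sc'.
by apply: bigcup_measurable => v _; exact: measurable_cell.
Qed.

Lemma dyadicI S U : dyadic S -> dyadic U -> dyadic (S `&` U).
Proof.
move=> [l Sl] [l' Ul']; exists (maxn l l') => c c' h [Sc Uc]; split.
  by apply: Sl Sc; apply: cell_coarser h; rewrite leq_maxl.
by apply: Ul' Uc; apply: cell_coarser h; rewrite leq_maxr.
Qed.

Lemma dyadicC S : dyadic S -> dyadic (~` S).
Proof. by move=> [l Sl]; exists l => c c' h nSc Sc'; apply: nSc; exact: Sl Sc'. Qed.

Lemma dyadicT : dyadic setT. Proof. by exists 0%N. Qed.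

Lemma dyadic_cell l v : dyadic [set c | cell 0 l c = v].
Proof. by exists l => c c' /= ->. Qed.

(** Means in one coordinate converge at [c] for indicators of dyadic sets. *)
Definition dyadic_approximation (k : nat -> C -> C -> R) c := forall S, dyadic S ->
  (fun N => \int[circ]_t (k N c t * \1_S t)) @ \oo --> (\1_S c : R).

Lemma Rintegral_indic (S : set C) : measurable S -> \int[circ]_t \1_S t = fine (circ S).
Proof. by move=> mS; rewrite /Rintegral integral_indic// setIT. Qed.

(** From the level of [S] on, the cell of [c] is inside [S] or disjoint from it. *)
Lemma cell_approximation c : dyadic_approximation (cell_kernel 0) c.
Proof.
move=> S [l Sl]; apply: (@cvg_near_cst _ _ _ _ _); exists l => // n /= ln.
pose A := [set t : C | cell 0 n t = cell 0 n c].
have mA : measurable A by exact: measurable_cell.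
have -> : (fun t => cell_kernel 0 n c t * \1_S t) = (fun t => (2 ^+ n * \1_S c) * \1_A t).
  apply/funext => t; rewrite /cell_kernel -mulrA -[RHS]mulrA; congr (_ * _).
  rewrite mulrC !indicE (_ : (t \in A) = (cell 0 n c == cell 0 n t)); last first.
    by apply/idP/eqP; rewrite in_setE /A /= => ->.
  case: eqP => [ct|_]; rewrite ?mulr0// !mulr1; congr (nat_of_bool _)%:R.
  apply/idP/idP; rewrite !in_setE; apply: Sl; apply: cell_coarser ln _ => //.
rewrite RintegralZl//; last first.
  apply: (@bounded_integrable _ _ _ _ _ 1); first exact: measurable_indic.
  by move=> t; rewrite indicE; case: (t \in A); rewrite ?normr1 ?normr0.
rewrite Rintegral_indic// circle_measure_cell ?cell_lt//= mulrAC mulfV ?mul1r//.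
Qed.

(** The point [c] is not the left end of its cell, at any level. *)
Definition off_grid c := forall l, (cell 0 l c)%:R / 2 ^+ l < crep c.

Lemma off_grid_neighbourhood c l : off_grid c ->
  exists2 e : R, 0 < e & forall y, `|y| < e -> cell 0 l (c - to_circle y) = cell 0 l c.
Proof.
move=> /(_ l) lc; have p0 : 0 < 2 ^+ l :> R by rewrite exprn_gt0.
have := cell_eqE 0 l c (cell 0 l c); rewrite eqxx addr0 => /esym/andP[_ cu].
set a := (cell 0 l c)%:R / 2 ^+ l in lc; set b := (cell 0 l c).+1%:R / 2 ^+ l in cu.
exists (Num.min (crep c - a) (b - crep c)); first by rewrite lt_min !subr_gt0 lc.
move=> y; rewrite lt_min !ltr_norml => /andP[/andP[_ y1] /andP[y2 _]].
have a0 : 0 <= a by rewrite divr_ge0// ltW.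
have b1 : b <= 1 by rewrite ler_pdivrMr// mul1r -natrX ler_nat cell_lt.
have cyE : crep (c - to_circle y) = crep c - y.
  rewrite -{1}(to_circle_crep c) -to_circleB crepE frac_id//.
  by apply/andP; split; lra.
by apply/eqP; rewrite cell_eqE addr0 cyE -/a -/b; apply/andP; split; lra.
Qed.

(** A dyadic set that does not contain [c] stays at a positive distance from [c],
    where the Fejér kernel is of order [1 / N]. *)
Lemma fejer_off_dyadic c U : off_grid c -> dyadic U -> ~ U c ->
  (fun N => \int[circ]_t (fejer_re N (c - t) * \1_U t)) @ \oo --> (0 : R).
Proof.
move=> oc dU nUc; have mU := measurable_dyadic dU; have [l Ul] := dU.
have [e e0 ec] := off_grid_neighbourhood l oc.
have bound N t : 0 <= fejer_re N (c - t) * \1_U t <= e ^- 2 * N.+1%:R^-1.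
  have i0 : 0 <= \1_U t :> R by rewrite indicE ler0n.
  rewrite (mulr_ge0 (fejer_re_ge0 _ _) i0) /=.
  rewrite indicE; case: (boolP (t \in U)) => [tU|_]; last first.
    by rewrite mulr0 mulr_ge0// invr_ge0 ?exprn_ge0 ?ltW.
  rewrite mulr1; have [y ctE y2] := symmetric_representative (c - t).
  have ye : e <= `|y|.
    rewrite leNgt; apply/negP => /ec; rewrite -ctE opprB addrC subrK => tc.
    by apply: nUc; apply: Ul tc _; rewrite -in_setE.
  have y0 : y != 0 by rewrite -normr_gt0 (lt_le_trans e0).
  rewrite ctE fejer_reE; apply: (le_trans (fejer_cos_tail _ y0 y2)).
  rewrite invfM mulrC; apply: ler_wpM2r; first by rewrite invr_ge0.
  have e2 : 0 < e ^+ 2 by rewrite exprn_gt0.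
  have yy : 0 < y ^+ 2 by rewrite exprn_even_gt0.
  rewrite lef_pV2 ?posrE//.
  by rewrite -[leRHS](real_normK (num_real y)) ler_pXn2r ?nnegrE// ltW.
have iK N : circ.-integrable setT (EFin \o (fun t => fejer_re N (c - t) * \1_U t)).
  apply: (@bounded_integrable _ _ _ _ _ (e ^- 2 * N.+1%:R^-1)).
    apply: measurable_funM; last exact: measurable_indic.
    exact: (measurableT_comp (@measurable_fejer_re R N) (measurable_circleBl c)).
  by move=> t; have /andP[b0 b1] := bound N t; rewrite ger0_norm.
apply: (@squeeze_cvgr _ _ _ _ (cst 0) (fun N => e ^- 2 * N.+1%:R^-1)).
- apply: nearW => N; apply/andP; split.
    by apply: Rintegral_ge0 => t _; have /andP[] := bound N t.
  apply: le_trans (le_Rintegral measurableT (iK N) _ (f2 := cst (e ^- 2 * N.+1%:R^-1)) _) _.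
  + exact: finite_measure_integrable_cst.
  + by move=> t _; have /andP[] := bound N t.
  by rewrite Rintegral_cst// [X in fine X](@probability_setT _ _ _ circ) mulr1.
- exact: cvg_cst.
- rewrite -[X in _ --> X](mulr0 (e ^- 2)); apply: cvgMr.
  exact: cvg_harmonic.
Qed.

(** The kernel has integral one, so the case of a set that contains [c] follows from
    that of its complement. *)
Lemma fejer_approximation c : off_grid c ->
  dyadic_approximation (fun N c t => fejer_re N (c - t)) c.
Proof.
move=> oc S dS; have mS := measurable_dyadic dS.
have [Sc|nSc] := pselect (S c); last first.
  by rewrite indicE memNset//; exact: fejer_off_dyadic.
have := fejer_off_dyadic oc (dyadicC dS) (fun h => h Sc).
rewrite indicE mem_set// => h.
have iK N (U : set C) : measurable U ->
    circ.-integrable setT (EFin \o (fun t => fejer_re N (c - t) * \1_U t)).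
  move=> mU; apply: (@bounded_integrable _ _ _ _ _ N.+1%:R).
    apply: measurable_funM; last exact: measurable_indic.
    exact: (measurableT_comp (@measurable_fejer_re R N) (measurable_circleBl c)).
  move=> t; rewrite normrM ger0_norm ?fejer_re_ge0// indicE.
  by case: (t \in U); rewrite ?normr1 ?normr0 ?mulr1 ?mulr0// fejer_re_le.
rewrite (_ : (fun N => _) = (fun N => 1 - \int[circ]_t (fejer_re N (c - t) * \1_(~` S) t))).
  by rewrite -[X in _ --> X](subr0 1); apply: cvgB => //; exact: cvg_cst.
apply/funext => N; rewrite -(integral_fejer_re N c); apply/eqP; rewrite eq_sym subr_eq; apply/eqP.
rewrite -RintegralD//; [|exact: iK|by apply: iK; exact: measurableC].
apply: eq_Rintegral => t _; rewrite -mulrDr !indicE in_setC.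
by case: (t \in S); rewrite /= ?addr0 ?add0r mulr1.
Qed.

Lemma cvg_prod_ord m (a : nat -> nat -> R) (L : nat -> R) :
  (forall j, (j < m)%N -> a j N @[N --> \oo] --> L j) ->
  \prod_(j < m) a j N @[N --> \oo] --> \prod_(j < m) L j.
Proof.
elim: m => [|m ih] h.
  under eq_fun do rewrite big_ord0; rewrite big_ord0; exact: cvg_cst.
under eq_fun do rewrite big_ord_recr /=; rewrite big_ord_recr /=.
by apply: cvgM; [apply: ih => j jm; apply: h; exact: ltnW|exact: h].
Qed.

(** The integrand is a product of functions of single coordinates; the coordinates from
    [p] on contribute the measures of the sides. *)
Lemma pmean_cylinder_cvg (k : nat -> C -> C -> R) p q (S : nat -> set C) x :
  (forall N, bounded_kernel (k N)) -> (forall j, dyadic_approximation k (x j)) ->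
  (forall j, dyadic (S j)) ->
  let S' j := if (j < q)%N then S j else setT in
  pmean (fun _ : 'I_p => k N) \1_(cylinder q S) x @[N --> \oo] -->
    \prod_(j < maxn p q) (if (j < p)%N then \1_(S' j) (x j) else fine (circ (S' j)) : R).
Proof.
move=> bk ak dS S'; set m := maxn p q.
have dS' j : dyadic (S' j) by rewrite /S'; case: ifP => // _; exact: dyadicT.
have mS' j : measurable (S' j) by exact: measurable_dyadic.
pose h N j c : R := (if (j < p)%N then k N (x j) c else 1) * \1_(S' j) c.
have E N : pmean (fun _ : 'I_p => k N) \1_(cylinder q S) x = \prod_(j < m) \int[circ]_c h N j c.
  have [_ [M kM]] := bk N.
  rewrite -(@Rintegral_torus_prod R m (h N) (1 + M)); last 2 first.
  - move=> j; apply: measurable_funM; last exact: measurable_indic.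
    by case: (j < p)%N; [have [mk _] := bk N; exact: mk|exact: measurable_cst].
  - move=> j c; have /andP[k0 k1] := kM (x j) c; rewrite /h indicE.
    by case: ifP => _; case: (c \in S' j); rewrite ?mulr1 ?mulr0; apply/andP; split; lra.
  apply: eq_Rintegral => t _; rewrite /h big_split /= -big_mkcond /=; congr (_ * _).
    by rewrite /kprod (big_ord_widen m (fun j => k N (x j) (t j)))// leq_maxl.
  rewrite indicE; have [/set_mem tS|/negP tS] := boolP (t \in cylinder q S).
    rewrite big1// => j _; rewrite indicE mem_set// /S'.
    by case: ifP => // jq; exact: tS.
  have [j [jq nS]] : exists j, (j < q)%N /\ ~ S j (t j).
    apply: contrapT => hn; apply: tS; rewrite in_setE => j jq.
    by apply: contrapT => nS; apply: hn; exists j.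
  have jm : (j < m)%N by rewrite leq_max jq orbT.
  by rewrite (bigD1 (Ordinal jm))//= indicE memNset ?mul0r// /S' jq.
under eq_fun do rewrite E.
apply: (@cvg_prod_ord m (fun j N => \int[circ]_c h N j c)
  (fun j => if (j < p)%N then \1_(S' j) (x j) else fine (circ (S' j)))) => j _.
rewrite /h; case: ifP => jp; first exact: ak.
under eq_fun do under eq_Rintegral do rewrite mul1r.
rewrite Rintegral_indic//; exact: cvg_cst.
Qed.

End dyadic_sets.

(** * Almost everywhere convergence *)

Section almost_everywhere_convergence.
Variable R : realType.
Notation C := (circle R).
Notation T := (torus R).
Notation mu := (torus_measure R).
Notation circ := (circle_measure R).
Notation L1 u := (mu.-integrable setT (EFin \o u)).
Notation fejer N := (fun c c' : C => fejer_re N (c - c')).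
Implicit Types (u v w : T -> R) (x t : T).

Lemma circle_measure_crep (a : R) :
  measurable [set c : C | crep c = a] /\ circ [set c : C | crep c = a] = 0%E.
Proof.
have mA : measurable [set c : C | crep c = a].
  rewrite -[X in measurable X]setTI.
  exact: (@measurable_crep R measurableT [set a] (measurable_set1 a)).
split=> //; rewrite /circle_measure /= /pushforward.
have mB : measurable (@to_circle R @^-1` [set c : C | crep c = a]).
  by rewrite -[X in measurable X]setTI; exact: measurable_to_circle.
rewrite uniform_prob01// uniform_probE; last exact: measurableI.
apply/eqP; rewrite eq_le measure_ge0 andbT.
apply: (@le_trans _ _ (lebesgue_measure [set a])); last by rewrite lebesgue_measure_set1.
apply: le_measure; rewrite ?inE//; first by apply: measurableI => //; exact: measurableI.
by move=> y [[/= ya]]; rewrite in_itv /= => y01 _; rewrite -ya crepE frac_id.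
Qed.

Lemma ae_off_grid : {ae mu, forall x : T, forall j, off_grid (x j)}.
Proof.
apply: (@ae_foralln _ _ _ mu (fun j x => off_grid (x j))) => j.
apply: (@ae_foralln _ _ _ mu (fun l x => (cell 0 l (x j))%:R / 2 ^+ l < crep (x j))) => l.
apply: (@negligibleS _ _ _ mu (\bigcup_v [set x : T | crep (x j) = v%:R / 2 ^+ l])).
  move=> x /= /negP; rewrite -leNgt => h; exists (cell 0 l (x j)) => //=.
  have := cell_eqE 0 l (x j) (cell 0 l (x j)); rewrite eqxx addr0 => /esym/andP[h' _].
  by apply/eqP; rewrite eq_le h h'.
apply: negligible_bigcup => v; set a := v%:R / 2 ^+ l.
have [mA A0] := circle_measure_crep a.
have [|mB B0] := @torus_measure_box R j.+1
  (fun i => if i == ord_max then [set c : C | crep c = a] else setT).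
  by move=> i; case: ifP.
exists [set x : T | forall i : 'I_j.+1, (if i == ord_max then [set c : C | crep c = a] else setT) (x i)].
split => //; first by apply: (etrans B0); rewrite (bigD1 ord_max)//= eqxx [X in (X * _)%E]A0 mul0e.
by move=> x /= xa i; case: eqP => // ->.
Qed.

(** The dyadic means are carried along with the Fejér means: they have the same limit
    [s p], and the maximal inequality that governs [p] going to infinity is proved for
    them. *)
Definition converging_means u x := exists s : nat -> R,
  (forall p, pmean (fun _ : 'I_p => fejer N) u x @[N --> \oo] --> s p /\
             pmean (fun _ : 'I_p => cell_kernel 0 n) u x @[n --> \oo] --> s p) /\
  s @ \oo --> u x.

Definition ae_convergent u := L1 u /\ {ae mu, forall x : T, converging_means u x}.

Lemma ae_convergent_cylinder q (S : nat -> set C) : (forall j, dyadic (S j)) ->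
  ae_convergent \1_(cylinder q S).
Proof.
move=> dS; split.
  apply: (@bounded_integrable _ _ _ _ _ 1).
    by apply: measurable_indic; apply: measurable_cylinder => j; exact: measurable_dyadic.
  by move=> t; rewrite indicE; case: (t \in _); rewrite ?normr1 ?normr0.
apply: (filterS _ ae_off_grid) => x ox.
pose S' j := if (j < q)%N then S j else setT.
exists (fun p => \prod_(j < maxn p q) (if (j < p)%N then \1_(S' j) (x j) else fine (circ (S' j)))).
split.
  move=> p; split; apply: pmean_cylinder_cvg => //.
  - by move=> N; exact: bounded_fejer.
  - by move=> j; exact: fejer_approximation.
  - by move=> N; exact: bounded_cell_kernel.
  - by move=> j; exact: cell_approximation.
apply: cvg_near_cst; exists q => // p /= qp.
rewrite (maxn_idPl qp); under eq_bigr => j _ do rewrite ltn_ord.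
rewrite indicE; have [/set_mem xS|/negP xS] := boolP (x \in cylinder q S).
  by rewrite big1// => j _; rewrite indicE mem_set// /S'; case: ifP => // jq; exact: xS.
have [j [jq nS]] : exists j, (j < q)%N /\ ~ S j (x j).
  apply: contrapT => hn; apply: xS; rewrite in_setE => j jq.
  by apply: contrapT => nS; apply: hn; exists j.
have jp : (j < p)%N by exact: leq_trans qp.
by rewrite (bigD1 (Ordinal jp))//= indicE memNset ?mul0r// /S' jq.
Qed.

Lemma ae_convergentD u v : ae_convergent u -> ae_convergent v -> ae_convergent (fun t => u t + v t).
Proof.
move=> [iu hu] [iv hv]; split; first exact: (integrableD measurableT iu iv).
move: hu hv; apply: filterS2 => x [s [s1 s2]] [r [r1 r2]].
exists (fun p => s p + r p); split; last exact: cvgD.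
move=> p; have [a1 a2] := s1 p; have [b1 b2] := r1 p; split.
  under eq_fun => N do rewrite (pmeanD _ (fun _ : 'I_p => bounded_fejer R N) iu iv).
  exact: cvgD.
under eq_fun => n do rewrite (pmeanD _ (fun _ : 'I_p => bounded_cell_kernel 0 n) iu iv).
exact: cvgD.
Qed.

Lemma ae_convergentZ (a : R) u : ae_convergent u -> ae_convergent (fun t => a * u t).
Proof.
move=> [iu hu]; split; first exact: (integrableZl measurableT a iu).
apply: (filterS _ hu) => x [s [s1 s2]].
exists (fun p => a * s p); split; last exact: cvgMr.
move=> p; have [a1 a2] := s1 p; split.
  under eq_fun => N do rewrite (pmeanZ _ _ (fun _ : 'I_p => bounded_fejer R N) iu).
  exact: cvgMr.
under eq_fun => n do rewrite (pmeanZ _ _ (fun _ : 'I_p => bounded_cell_kernel 0 n) iu).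
exact: cvgMr.
Qed.

Definition L1_closure u := forall e : R, 0 < e ->
  exists2 v, ae_convergent v & (\int[mu]_t `|u t - v t|%:E <= e%:E)%E.

(** For fixed [n], the dyadic means of level [n] in [p] coordinates form a martingale
    in [p], which gives an exceptional set [B n] with a bound uniform in [n]. A limit
    in [n] can exceed [lam] only on the lower limit of the sets [B n]. *)
Lemma limit_means_maximal w (lam : R) : L1 w -> 0 < lam ->
  exists B, [/\ measurable B, (lam%:E * mu B <= \int[mu]_t `|w t|%:E)%E &
    forall x, ~ B x -> forall p (s : R),
      pmean (fun _ : 'I_p => cell_kernel 0 n) w x @[n --> \oo] --> s -> `|s| <= lam].
Proof.
move=> iw lam0.
have /choice[B hB] : forall n, exists B, [/\ measurable B,
    (lam%:E * mu B <= \int[mu]_t `|w t|%:E)%E &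
    forall x, ~ B x -> forall p,
      pmean (fun _ : 'I_p => cell_kernel 0 n) (fun t => `|w t|) x <= lam].
  move=> n; apply: (@cell_mean_maximal R id (fun _ _ => 0) (fun _ _ => n)) => //.
  move=> p x y /tcellP h; apply/tcellP => j.
  exact: (h (widen_ord (leqnSn p) j)).
have mB n : measurable (B n) by have [] := hB n.
pose D m := \bigcap_(n in [set n | (m <= n)%N]) B n.
have mD m : measurable (D m) by apply: bigcap_measurableType.
exists (\bigcup_m D m); split; first exact: bigcupT_measurable.
  rewrite -lee_pdivlMl//; apply: measure_bigcup_le => //.
    move=> m n mn; apply/subsetPset => x Dx k /= nk.
    by apply: Dx => /=; exact: leq_trans nk.
  move=> m; rewrite lee_pdivlMl//; have [_ lB _] := hB m; apply: le_trans lB.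
  apply: lee_wpmul2l; first by rewrite lee_fin ltW.
  by apply: le_measure; rewrite ?inE// => x; apply => /=.
move=> x nDx p s ws.
have freq m : exists2 n, (m <= n)%N & ~ B n x.
  apply: contrapT => h; apply: nDx; exists m => // n /= mn.
  by apply: contrapT => nB; apply: h; exists n.
rewrite leNgt; apply/negP => slam.
have /cvgr_dist_lt /(_ (`|s| - lam)) := ws.
rewrite subr_gt0 => /(_ slam) [m _ hm].
have [n mn nB] := freq m.
have [_ _ /(_ x nB p)] := hB n; have := hm n mn; rewrite /=.
have := normr_pmean x (fun _ : 'I_p => bounded_cell_kernel 0 n) iw.
have := ler_normB s (s - pmean (fun _ : 'I_p => cell_kernel 0 n) w x).
rewrite subKr.
have := ler_distD 0 s (pmean (fun _ : 'I_p => cell_kernel 0 n) w x).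
have := lerB_dist s (pmean (fun _ : 'I_p => cell_kernel 0 n) w x).
lra.
Qed.

End almost_everywhere_convergence.

(** * Closure under limits in the mean *)

Section closure.
Variable R : realType.
Notation C := (circle R).
Notation T := (torus R).
Notation mu := (torus_measure R).
Notation L1 u := (mu.-integrable setT (EFin \o u)).
Notation fejer N := (fun c c' : C => fejer_re N (c - c')).
Implicit Types (u v w : T -> R) (x t : T).

(** Mutual closeness of the two sequences makes each of them Cauchy. *)
Lemma joint_cauchy (a b : nat -> R) :
  (forall k, exists m, forall N n, (m <= N)%N -> (m <= n)%N -> `|a N - b n| <= k.+1%:R^-1) ->
  exists s : R, a @ \oo --> s /\ b @ \oo --> s.
Proof.
move=> h.
have cb : cvg (b @ \oo).
  apply/cauchy_cvgP/cauchy_exP => e e0.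
  have [k ke] := @inv_succ_le _ (e / 2) ltac:(lra); have [m hm] := h k.
  exists (a m), m => // n /= mn; rewrite /ball /=.
  by apply: (le_lt_trans (hm m n (leqnn m) mn)); apply: (le_lt_trans ke); lra.
exists (limn b); split => //; apply/cvgrPdist_le => e e0.
have [k ke] := @inv_succ_le _ (e / 2) ltac:(lra); have [m hm] := h k.
have /cvgrPdist_le /(_ (e / 2)) := cb; rewrite divr_gt0// => /(_ isT) [m' _ hm'].
exists m => // N /= mN; have := hm' (maxn m m') (leq_maxr _ _) => /=.
have := hm N (maxn m m') mN (leq_maxl _ _).
move=> h1 h2; apply: (le_trans (ler_distD (b (maxn m m')) _ _)).
by rewrite [`|b _ - a N|]distrC [e]splitr lerD// (le_trans h1).
Qed.

Lemma pmean_split p (k : 'I_p -> C -> C -> R) u v x : (forall j, bounded_kernel (k j)) ->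
  L1 u -> L1 v -> pmean k u x = pmean k (fun t => u t - v t) x + pmean k v x.
Proof. by move=> bk iu iv; rewrite pmeanB// subrK. Qed.

(** Banach's principle for fixed [p]: the difference between a Fejér mean and a dyadic
    mean of [u] tends to zero along [v], and the means of [u - v] are small outside a
    small set by the two maximal inequalities. *)
Lemma means_cvg u : L1 u -> L1_closure u -> {ae mu, forall x : T, forall p, exists s : R,
  pmean (fun _ : 'I_p => fejer N) u x @[N --> \oo] --> s /\
  pmean (fun _ : 'I_p => cell_kernel 0 n) u x @[n --> \oo] --> s}.
Proof.
move=> iu cu; apply: (@ae_foralln _ _ _ mu (fun p x => exists s : R,
  pmean (fun _ : 'I_p => fejer N) u x @[N --> \oo] --> s /\
  pmean (fun _ : 'I_p => cell_kernel 0 n) u x @[n --> \oo] --> s)) => p.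
pose FN N u x := pmean (fun _ : 'I_p => fejer N) u x.
pose DN n u x := pmean (fun _ : 'I_p => cell_kernel 0 n) u x.
suff : {ae mu, forall x : T, forall k, exists m, forall N n, (m <= N)%N -> (m <= n)%N ->
    `|FN N u x - DN n u x| <= k.+1%:R^-1}.
  by apply: filterS => x; exact: joint_cauchy.
apply: (@ae_foralln _ _ _ mu (fun k x => exists m, forall N n, (m <= N)%N -> (m <= n)%N ->
    `|FN N u x - DN n u x| <= k.+1%:R^-1)) => k.
pose lam : R := k.+1%:R^-1 / 3; have lam0 : 0 < lam by rewrite divr_gt0.
pose K : R := (6 ^+ 3 * 8) ^+ p.
have K0 : 0 <= K by rewrite exprn_ge0// mulr_ge0// exprn_ge0.
apply: negligible_small => e e0.
have [|v [iv gv] uv] := cu (e * lam / (K + 1)).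
  by rewrite divr_gt0 ?mulr_gt0// ltr_wpDl.
have iw := L1B iu iv.
have [B1 [mB1 lB1 xB1]] := fejer_maximal p iw lam0.
have [//|B2 [mB2 lB2 xB2]] := @cell_mean_maximal R (fun _ => p) (fun _ _ => 0) (fun n _ => n)
  _ lam _ iw lam0.
  by move=> n x y /tcellP h; apply/tcellP => j; exact: cell_coarser (h j).
exists (B1 `|` B2), (~` [set x | converging_means v x]); split => //.
- exact: measurableU.
- apply: (le_trans (measureU2 _ mB1 mB2)).
  apply: (le_trans (leeD (measure_le_div lam0 K0 lB1 uv) (measure_le_div (K := 1) lam0 ler01 _ uv))).
    by rewrite mul1e.
  rewrite -EFinD lee_fin le_eqVlt; apply/orP; left; apply/eqP; field.
  by rewrite !lt0r_neq0// ltr_wpDl.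
move=> x; apply: contra_notP => /not_orP[nB /contrapT [s [+ _]]] => /(_ p) [s1 s2].
have [nB1 nB2] : ~ B1 x /\ ~ B2 x by split => ?; apply: nB; [left|right].
have /cvgrPdist_le /(_ (lam / 2)) := s1; rewrite divr_gt0// => /(_ isT) [m1 _ h1].
have /cvgrPdist_le /(_ (lam / 2)) := s2; rewrite divr_gt0// => /(_ isT) [m2 _ h2].
exists (maxn m1 m2) => N n; rewrite !geq_max => /andP[mN _] /andP[_ mn].
have {}h1 : `|s p - FN N v x| <= lam / 2 := h1 N mN.
have {}h2 : `|s p - DN n v x| <= lam / 2 := h2 n mn.
have := xB1 x nB1 N; have := xB2 x nB2 n.
have := normr_pmean x (fun _ : 'I_p => bounded_cell_kernel 0 n) iw.
have := normr_pmean x (fun _ : 'I_p => bounded_fejer R N) iw.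
have := pmean_split x (fun _ : 'I_p => bounded_cell_kernel 0 n) iu iv.
have := pmean_split x (fun _ : 'I_p => bounded_fejer R N) iu iv.
rewrite -/(FN N u x) -/(DN n u x) -/(FN N v x) -/(DN n v x).
set fw := pmean _ _ _; set dw := pmean _ _ _; set fa := pmean _ _ _; set da := pmean _ _ _.
move=> -> -> hf hd hd' hf'.
have -> : fw + FN N v x - (dw + DN n v x) =
    fw - dw + ((s p - DN n v x) - (s p - FN N v x)) by ring.
apply: (le_trans (ler_normD _ _)).
have := ler_normB fw dw; have := ler_normB (s p - DN n v x) (s p - FN N v x).
have k3 : k.+1%:R^-1 = 3 * lam by rewrite /lam; field; rewrite nat1r pnatr_eq0.
rewrite k3; lra.
Qed.

(** Banach's principle for [p] going to infinity, with the maximal inequality for the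
    limits of dyadic means and Markov's inequality for [u - v] itself. *)
Lemma ae_convergent_closed u : L1 u -> L1_closure u -> ae_convergent u.
Proof.
move=> iu cu; split => //; have cvu := means_cvg iu cu.
pose DN p n u x := pmean (fun _ : 'I_p => cell_kernel 0 n) u x.
pose sp p x := limn (fun n => DN p n u x).
suff : {ae mu, forall x : T, forall k, exists m, forall p, (m <= p)%N ->
    `|u x - sp p x| <= k.+1%:R^-1}.
  move: cvu; apply: filterS2 => x hx hs; exists (fun p => sp p x); split.
    move=> p; have [s [s1 s2]] := hx p.
    by have -> : sp p x = s by exact: (cvg_lim _ s2).
  apply/cvgrPdist_le => e e0.
  have [k ke] := inv_succ_le e0.
  have [m hm] := hs k; exists m => // p /= mp; exact: le_trans (hm p mp) ke.
apply: (@ae_foralln _ _ _ mu (fun k x => exists m, forall p, (m <= p)%N ->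
    `|u x - sp p x| <= k.+1%:R^-1)) => k.
pose lam : R := k.+1%:R^-1 / 3; have lam0 : 0 < lam by rewrite divr_gt0.
apply: negligible_small => e e0.
have [|v gv uv] := cu (e * lam / 2); first by rewrite divr_gt0 ?mulr_gt0.
have [iv cv] := gv; have iw := L1B iu iv.
have [B1 [mB1 lB1 xB1]] := limit_means_maximal iw lam0.
have [B2 [mB2 lB2 xB2]] := L1_markov iw lam0.
pose X x := converging_means v x /\ forall p, exists s : R, DN p n u x @[n --> \oo] --> s.
have aX : {ae mu, forall x : T, X x}.
  move: cv cvu; apply: filterS2 => x h1 h2; split => // p.
  by have [s [_ s2]] := h2 p; exists s.
exists (B1 `|` B2), (~` [set x | X x]); split => //.
- exact: measurableU.
- apply: (le_trans (measureU2 _ mB1 mB2)).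
  apply: (le_trans (leeD (measure_le_div (K := 1) lam0 ler01 _ uv)
    (measure_le_div (K := 1) lam0 ler01 _ uv))); rewrite ?mul1e//.
  rewrite -EFinD lee_fin le_eqVlt; apply/orP; left; apply/eqP; field.
  by rewrite lt0r_neq0.
move=> x; apply: contra_notP => /not_orP[nB /contrapT [[r [hr rv]] hu]].
have [nB1 nB2] : ~ B1 x /\ ~ B2 x by split => ?; apply: nB; [left|right].
have /cvgrPdist_le /(_ lam lam0) [m _ hm] := rv.
exists m => p mp; have {}hm : `|v x - r p| <= lam := hm p mp.
have [s s2] := hu p; have spE : sp p x = s by exact: (cvg_lim _ s2).
have [_ r2] := hr p.
have sr : `|s - r p| <= lam.
  apply: (xB1 x nB1 p); rewrite -/(DN p _ _ x).
  under eq_fun => n do rewrite (pmeanB _ (fun _ : 'I_p => bounded_cell_kernel 0 n) iu iv).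
  exact: cvgB.
have := xB2 x nB2; rewrite spE => h2.
have -> : u x - s = (u x - v x) + (v x - r p) - (s - r p) by ring.
apply: (le_trans (ler_normB _ _)); have := ler_normD (u x - v x) (v x - r p).
have k3 : k.+1%:R^-1 = 3 * lam by rewrite /lam; field; rewrite nat1r pnatr_eq0.
rewrite k3; lra.
Qed.

End closure.

(** * From cylinders to integrable functions *)

Import HBSimple.

Section all_integrable_functions.
Variable R : realType.
Notation C := (circle R).
Notation T := (torus R).
Notation mu := (torus_measure R).
Notation L1 u := (mu.-integrable setT (EFin \o u)).
Implicit Types (u v w : T -> R) (x t : T).

Definition dyadic_cylinders : set (set T) :=
  [set E | exists q S, (forall j, dyadic (S j)) /\ E = cylinder q S].

Lemma dyadic_cylindersI : setI_closed dyadic_cylinders.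
Proof.
move=> _ _ [q [S [dS ->]]] [q' [S' [dS' ->]]]; rewrite cylinderI.
eexists; eexists; split; last reflexivity.
by move=> j; apply: dyadicI; case: ifP => // _; exact: dyadicT.
Qed.

Let gT := g_sigma_algebraType dyadic_cylinders.

Let measurable_cell_coord n l : measurable_fun setT
  ((fun x => (cell 0 l (x n))%:R / 2 ^+ l) : gT -> measurableTypeR R).
Proof.
move=> _ Y mY; rewrite setTI.
rewrite (_ : _ @^-1` Y = \bigcup_(v in [set v : nat | Y (v%:R / 2 ^+ l)])
    (cylinder n.+1 (fun k => if k == n then [set c : C | cell 0 l c = v] else setT) : set gT)).
  apply: bigcup_measurable => v _; apply: sub_sigma_algebra.
  exists n.+1, (fun k => if k == n then [set c : C | cell 0 l c = v] else setT).
  by split => // j; case: ifP => _; [exact: dyadic_cell|exact: dyadicT].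
apply/seteqP; split => x /=.
  by move=> Yx; exists (cell 0 l (x n)) => //= k _; case: eqP => // ->.
by move=> [v Yv /(_ n (ltnSn n))]; rewrite eqxx /= => ->.
Qed.

Let measurable_crep_coord n : measurable_fun setT
  ((fun x => crep (x n)) : gT -> measurableTypeR R).
Proof.
apply: (measurable_fun_cvg (measurable_cell_coord n)) => x _.
apply/cvgrPdist_le => e e0.
have [k ke] := inv_succ_le e0.
exists k.+1 => // l /= kl; have p0 : 0 < 2 ^+ l :> R by rewrite exprn_gt0.
have := cell_eqE 0 l (x n) (cell 0 l (x n)); rewrite eqxx addr0 => /esym/andP[h1 h2].
rewrite ger0_norm ?subr_ge0//; apply: le_trans ke.
apply: (@le_trans _ _ (2 ^- l)).
  by move: h2; rewrite -natr1 mulrDl mul1r => h2; lra.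
rewrite lef_pV2 ?posrE// -natrX ler_nat.
by apply: (leq_trans kl); exact/ltnW/ltn_expl.
Qed.

(** A coordinate is the limit of its dyadic approximations, hence measurable for the
    sigma-algebra generated by dyadic cylinders. *)
Lemma measurable_dyadic_cylinders : @measurable _ T = <<s dyadic_cylinders >>.
Proof.
apply/seteqP; split.
  apply: smallest_sub; first exact: smallest_sigma_algebra.
  move=> _ [n _ [A mA <-]]; rewrite setTI.
  rewrite (_ : _ @^-1` A = (fun x => crep (x n)) @^-1` (@to_circle R @^-1` A)).
    rewrite -[X in _ X]setTI; apply: (@measurable_crep_coord n measurableT).
    by have := @measurable_to_circle R measurableT A mA; rewrite setTI.
  by apply/funext => x /=; rewrite to_circle_crep.
apply: smallest_sub; first exact: sigma_algebra_measurable.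
move=> _ [q [S [dS ->]]]; apply: measurable_cylinder => j; exact: measurable_dyadic.
Qed.

Lemma eq_ae_convergent u v : u =1 v -> ae_convergent u -> ae_convergent v.
Proof. by move=> /funext ->. Qed.

Lemma ae_convergent_sum (I : Type) (s : seq I) (F : I -> T -> R) : (forall i, ae_convergent (F i)) ->
  ae_convergent (fun t => \sum_(i <- s) F i t).
Proof.
move=> gF; elim: s => [|i s ih]; last first.
  apply: (eq_ae_convergent _ (ae_convergentD (gF i) ih)) => t; by rewrite big_cons.
have := ae_convergentZ 0 (ae_convergent_cylinder 0 (fun _ => dyadicT R)).
by apply: eq_ae_convergent => t; rewrite big_nil mul0r.
Qed.

(** Dynkin's theorem; a countable disjoint union is the limit in the mean of its finite
    subunions. *)
Lemma ae_convergent_indic E : measurable E -> ae_convergent (\1_E : T -> R).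
Proof.
have gT1 : ae_convergent (\1_setT : T -> R).
  rewrite (_ : setT = cylinder 0 (fun=> setT)).
    exact: (ae_convergent_cylinder 0 (fun _ => dyadicT R)).
  by apply/seteqP; split.
rewrite measurable_dyadic_cylinders; move: E.
apply: (dynkin_induction measurable_dyadic_cylinders dyadic_cylindersI) => //.
- by move=> _ [q [S [dS ->]]]; exact: ae_convergent_cylinder.
- move=> S mS gS; apply: (eq_ae_convergent _ (ae_convergentD gT1 (ae_convergentZ (-1) gS))) => t.
  by rewrite !indicE in_setC in_setT mulN1r; case: (t \in S); rewrite ?subrr ?subr0.
move=> F mF tF gF; set U := \bigcup_k F k.
have mU : measurable U by exact: bigcupT_measurable.
apply: ae_convergent_closed.
  apply: (@bounded_integrable _ _ _ _ _ 1); first exact: measurable_indic.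
  by move=> t; rewrite indicE; case: (t \in _); rewrite ?normr1 ?normr0.
move=> e e0; pose G n := \big[setU/set0]_(k < n) F k.
have mG n : measurable (G n) by apply: bigsetU_measurable.
have GU n : G n `<=` U by move=> x; rewrite /G -bigcup_mkord => -[k _ Fk]; exists k.
have gG n : ae_convergent (\1_(G n) : T -> R).
  elim: n => [|n ih].
    apply: (eq_ae_convergent _ (ae_convergentZ 0 gT1)) => t.
    by rewrite /G big_ord0 indic0 mul0r.
  apply: (eq_ae_convergent _ (ae_convergentD ih (gF n))) => t; rewrite /G big_ord_recr /= -/(G n).
  rewrite !indicE in_setU.
  have [/set_mem Gt|_] := boolP (t \in G n); last by rewrite add0r.
  rewrite memNset ?addr0// => Ft.
  move: Gt; rewrite /G -bigcup_mkord => -[k /= kn Fkt].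
  have /trivIsetP /(_ k n Logic.I Logic.I) := tF.
  by rewrite ltn_eqF// => /(_ isT); rewrite -subset0 => /(_ t); apply.
have UE : U = \bigcup_n G n.
  apply/seteqP; split => [x [k _ Fk]|x [n _ Gx]]; last exact: GU Gx.
  by exists k.+1 => //; rewrite /G -bigcup_mkord; exists k => /=.
have ndG : nondecreasing_seq G by move=> m n mn; apply/subsetPset; exact: subset_bigsetU.
have finE A : measurable A -> mu A = (fine (mu A))%:E.
  by move=> mA; rewrite fineK//; exact: fin_num_measure.
have mD n : measurable (U `\` G n) by exact: measurableD.
have split_U n : fine (mu U) = fine (mu (U `\` G n)) + fine (mu (G n)).
  apply: EFin_inj; rewrite EFinD -!finE// (measureDI mu mU (mG n)).
  by congr (_ + mu _)%E; exact: setIidr.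
have [n hn] : exists n, fine (mu (U `\` G n)) <= e.
  apply: contrapT => hn.
  have : (mu U <= (fine (mu U) - e)%:E)%E.
    rewrite {1}UE; apply: measure_bigcup_le => // n.
    have dn : e < fine (mu (U `\` G n)).
      by rewrite ltNge; apply/negP => h; apply: hn; exists n.
    by rewrite [X in (X <= _)%E]finE// lee_fin (split_U n); lra.
  by rewrite [X in (X <= _)%E]finE// lee_fin; lra.
exists (\1_(G n)) => //; apply: le_trans (_ : (mu (U `\` G n) <= _)%E); last first.
  by rewrite finE// lee_fin.
rewrite -[X in (_ <= mu X)%E]setIT -integral_indic// le_eqVlt; apply/orP; left; apply/eqP.
apply: eq_integral => t _; congr (_%:E); rewrite !indicE in_setD.
have [/set_mem Gt|_] := boolP (t \in G n).
  by rewrite (mem_set (GU n t Gt)) subrr normr0.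
by rewrite subr0 andbT normr_nat.
Qed.

Lemma ae_convergent_sfun (g : {sfun T >-> R}) : ae_convergent (g : T -> R).
Proof.
have gF (y : R) : ae_convergent (fun t => y * \1_(g @^-1` [set y]) t).
  apply: ae_convergentZ; apply: ae_convergent_indic; rewrite -[X in measurable X]setTI.
  exact: measurable_funP.
apply: (eq_ae_convergent _ (ae_convergent_sum (finmap.enum_fset (fset_set (range g))) gF)) => t.
by rewrite [RHS]fimfunE fsbig_finite.
Qed.

Lemma ae_convergent_L1 u : L1 u -> ae_convergent u.
Proof.
move=> iu; apply: ae_convergent_closed => // e e0.
have [g [ig _ gu]] := approximation_sfun_integrable measurableT iu.
have gE n : (\int[mu]_z `|(EFin \o u) z - (g n z)%:E| = \int[mu]_t `|u t - g n t|%:E)%E.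
  by apply: eq_integral => t _.
have [n hn] : exists n, (\int[mu]_t `|u t - g n t|%:E <= e%:E)%E.
  have /fine_cvgP[[n1 _ h1] /cvgrPdist_le /(_ e e0) [n2 _ h2]] := gu.
  exists (maxn n1 n2); rewrite -gE.
  have /= h3 := h2 _ (leq_maxr n1 n2); have /= h4 := h1 _ (leq_maxl n1 n2).
  rewrite -(fineK h4) lee_fin; apply: le_trans h3.
  by rewrite sub0r normrN ler_norm.
exists (g n : T -> R) => //; exact: ae_convergent_sfun.
Qed.

End all_integrable_functions.

(** * Complex-valued functions *)

Section complex_means.
Variable R : realType.
Implicit Types (f : torus R -> R[i]) (x : torus R).

Lemma cvg_complex (a b : nat -> R) (l m : R) : a @ \oo --> l -> b @ \oo --> m ->
  (fun N => (a N +i* b N)%C : R[i]^o) @ \oo --> ((l +i* m)%C : R[i]^o).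
Proof.
move=> al bm; apply/cvgrPdist_le => -[e e'] /=; rewrite ltcE /= => /andP[/eqP -> e0].
have /cvgrPdist_le /(_ (e / 2)) := al; rewrite divr_gt0// => /(_ isT) [k1 _ h1].
have /cvgrPdist_le /(_ (e / 2)) := bm; rewrite divr_gt0// => /(_ isT) [k2 _ h2].
exists (maxn k1 k2) => // N /=; rewrite geq_max => /andP[/h1 /= {}h1 /h2 /= {}h2].
rewrite normc_def lecE /= eqxx /=.
apply: (@le_trans _ _ (`|l - a N| + `|m - b N|)); last by rewrite [e]splitr lerD.
have s0 : 0 <= `|l - a N| + `|m - b N| by rewrite addr_ge0.
rewrite -[leRHS](ger0_norm s0) -sqrtr_sqr ler_sqrt ?sqr_ge0// [leRHS]sqrrD !real_normK ?num_real//.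
by rewrite addrAC lerDl mulrn_wge0// mulr_ge0.
Qed.

Lemma fejer_meanE f p N x : fejer_mean f (fun _ : 'I_p => N) x =
  (pmean (fun (_ : 'I_p) c c' => fejer_re N (c - c')) (fun t => complex.Re (f t)) x +i*
   pmean (fun (_ : 'I_p) c c' => fejer_re N (c - c')) (fun t => complex.Im (f t)) x)%C.
Proof.
have E (t : torus R) : \prod_(j < p) fejer_kernel N (x j - t j) =
    (kprod (fun (_ : 'I_p) c c' => fejer_re N (c - c')) x t)%:C.
  by rewrite /kprod rmorph_prod /=; apply: eq_bigr => j _; rewrite fejer_kernel_re.
rewrite /fejer_mean /cintegral /pmean; congr (_ +i* _)%C;
  apply: eq_Rintegral => t _; rewrite E; case: (f t) => a b /=;
  by rewrite mul0r ?subr0 ?addr0 ?add0r.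
Qed.

End complex_means.

Theorem mainTheorem1 (R : realType) (f : torus R -> R[i])
    (hf : cintegrable (torus_measure R) f) :
  {ae torus_measure R, forall x : torus R,
    exists sigma : nat -> R[i],
      (forall p : nat, (0 < p)%N ->
        (fun N : nat => fejer_mean f (fun _ : 'I_p => N) x : R[i]^o) @ \oo
          --> (sigma p : R[i]^o)) /\
      (fun p : nat => sigma p : R[i]^o) @ \oo --> (f x : R[i]^o)}.
Proof.
have [/ae_convergent_L1[_ hr] /ae_convergent_L1[_ hi]] := hf.
move: hr hi; apply: filterS2 => x [s [hs sx]] [r [hr rx]].
exists (fun p => (s p +i* r p)%C); split.
  move=> p _; have [s1 _] := hs p; have [r1 _] := hr p.
  rewrite (_ : (fun N => _) = (fun N =>
    (pmean (fun (_ : 'I_p) c c' => fejer_re N (c - c')) (fun t => complex.Re (f t)) x +i*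
     pmean (fun (_ : 'I_p) c c' => fejer_re N (c - c')) (fun t => complex.Im (f t)) x)%C : R[i]^o)).
    exact: cvg_complex.
  by apply/funext => N; rewrite fejer_meanE.
have -> : f x = (complex.Re (f x) +i* complex.Im (f x))%C by case: (f x).
exact: cvg_complex.
Qed.
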